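(* For integers $i,j,n\ge 0$, let $a_{i,j}(n)$ be the number of walks $(w_0,w_1,\dots,w_n)$ in $\mathbb{Z}^2$ with $w_0=(0,0)$, $w_n=(i,j)$, $w_k-w_{k-1}\in\{(0,-1),(-1,0),(1,1)\}$ for $1\le k\le n$, and all vertices $w_k$ in the first quadrant $\{(a,b): a\ge 0,\ b\ge 0\}$. Let $$Q(x,y;t)=\sum_{i,j,n\ge 0} a_{i,j}(n)\,x^i y^j t^n .$$ Let $X\equiv X(t)$ be the power series in $t$ defined by $$X=t(2+X^3).$$ Then the generating function of the walks ending on the $x$-axis is $$Q(x,0;t)=\frac{1}{tx}\left(\frac{1}{2t}-\frac{1}{x}-\left(\frac{1}{X}-\frac{1}{x}\right)\sqrt{1-xX^2}\right).$$ Consequently, for every $i\ge 0$, the length generating function of the walks ending at $(i,0)$ is $$[x^i]\,Q(x,0;t)=\sum_{n\ge 0}a_{i,0}(n)t^n=\frac{X^{2i+1}}{2\cdot 4^i\, t}\left(C_i-\frac{C_{i+1}X^3}{4}\right),$$ where $C_i=\frac{1}{i+1}\binom{2i}{i}$ is the $i$-th Catalan number. Moreover, for all $i,n\ge 0$, the number of such walks of length $3n+2i$ is $$a_{i,0}(3n+2i)=\frac{4^n(2i+1)}{(n+i+1)(2n+2i+1)}\binom{2i}{i}\binom{3n+2i}{n}.$$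
   Context: The length of a walk $(w_0,\dots,w_n)$ is its number of steps $n$. The equation $X=t(2+X^3)$ has a unique solution that is a formal power series in $t$; it satisfies $X=2t+O(t^4)$, so $1/X$ is a Laurent series in $t$. The square root $\sqrt{1-xX^2}$ denotes the formal power series in $t$ (with coefficients polynomial in $x$) having constant term $1$. The identity for $Q(x,0;t)$ is an identity of Laurent series in $t$ whose coefficients are Laurent polynomials in $x$. The notation $[x^i]F$ means the coefficient of $x^i$ in $F$. *)

(* Defs.v *)
From HB Require Import structures.
From mathcomp Require Import all_boot all_order all_algebra.
From mathcomp Require Import finmap.
From mathcomp Require Import mathcomp_extra boolp classical_sets functions.
From mathcomp Require Import cardinality fsbigop.
From mathcomp Require Import zify.

Set Implicit Arguments.
Unset Strict Implicit.
Unset Printing Implicit Defensive.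

Import Order.TTheory GRing.Theory Num.Theory.
Local Open Scope ring_scope.

(* Formal power series in t: [F n] is the coefficient of t^n in F. *)

Record fps (R : Type) := Fps { fps_coef :> nat -> R }.

Notation "{ 'fps' R }" := (fps R) (at level 0, format "{ 'fps'  R }").

HB.instance Definition _ (R : Type) := gen_eqMixin {fps R}.
HB.instance Definition _ (R : Type) := gen_choiceMixin {fps R}.

Lemma fpsP (R : Type) (f g : {fps R}) : f =1 g -> f = g.
Proof. by case: f g => [f] [g] /= /funext ->. Qed.

Section FpsRing.
Variable R : comNzRingType.
Implicit Types f g h : {fps R}.

Definition fpsC (c : R) : {fps R} := Fps (fun n => if n == 0%N then c else 0).
Definition fpsX : {fps R} := Fps (fun n => (n == 1%N)%:R).
Definition fps_add f g : {fps R} := Fps (fun n => f n + g n).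
Definition fps_opp f : {fps R} := Fps (fun n => - f n).
Definition fps_mul f g : {fps R} :=
  Fps (fun n => \sum_(i < n.+1) f i * g (n - i)%N).

Fact fps_addA : associative fps_add.
Proof. by move=> f g h; apply: fpsP => n /=; rewrite addrA. Qed.
Fact fps_addC : commutative fps_add.
Proof. by move=> f g; apply: fpsP => n /=; rewrite addrC. Qed.
Fact fps_add0 : left_id (fpsC 0) fps_add.
Proof. by move=> f; apply: fpsP => n /=; rewrite if_same add0r. Qed.
Fact fps_addN : left_inverse (fpsC 0) fps_opp fps_add.
Proof. by move=> f; apply: fpsP => n /=; rewrite if_same addNr. Qed.

HB.instance Definition _ :=
  GRing.isZmodule.Build {fps R} fps_addA fps_addC fps_add0 fps_addN.

Definition fps_trunc m f : {poly R} := \poly_(i < m.+1) f i.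

Lemma coef_fps_trunc m f i : (i <= m)%N -> (fps_trunc m f)`_i = f i.
Proof. by move=> im; rewrite coef_poly ltnS im. Qed.

Lemma fps_mulE m f g (p q : {poly R}) :
  (forall i, (i <= m)%N -> p`_i = f i) ->
  (forall i, (i <= m)%N -> q`_i = g i) ->
  forall i, (i <= m)%N -> (p * q)`_i = fps_mul f g i.
Proof.
move=> pf qg i im; rewrite coefM; apply: eq_bigr => j _.
by rewrite pf ?qg //; have := ltn_ord j; lia.
Qed.

Fact fps_mulA : associative fps_mul.
Proof.
move=> f g h; apply: fpsP => n; set T := fps_trunc n.
have TE u i : (i <= n)%N -> (T u)`_i = u i by apply: coef_fps_trunc.
rewrite -(fps_mulE (TE f) (fps_mulE (TE g) (TE h)))//.
by rewrite -(fps_mulE (fps_mulE (TE f) (TE g)) (TE h))// mulrA.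
Qed.

Fact fps_mulC : commutative fps_mul.
Proof.
move=> f g; apply: fpsP => n; have TE u := @coef_fps_trunc n u.
by rewrite -(fps_mulE (TE f) (TE g))// -(fps_mulE (TE g) (TE f))// mulrC.
Qed.

Fact fps_mul1 : left_id (fpsC 1) fps_mul.
Proof.
move=> f; apply: fpsP => n /=; rewrite big_ord_recl /= subn0 mul1r.
by rewrite big1 ?addr0// => i _; rewrite mul0r.
Qed.

Fact fps_mulDl : left_distributive fps_mul fps_add.
Proof.
move=> f g h; apply: fpsP => n /=; rewrite -big_split /=.
by apply: eq_bigr => i _; rewrite mulrDl.
Qed.

Fact fps_1neq0 : fpsC 1 != 0.
Proof.
by apply/eqP => /(congr1 (fun f : {fps R} => f 0%N)) /eqP; rewrite oner_eq0.
Qed.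

HB.instance Definition _ := GRing.Zmodule_isComNzRing.Build {fps R}
  fps_mulA fps_mulC fps_mul1 fps_mulDl fps_1neq0.

End FpsRing.

Arguments fpsX {R}.

Definition fps_map (R S : Type) (phi : R -> S) (f : {fps R}) : {fps S} :=
  Fps (fun n => phi (f n)).

Section FpsFixpoint.
Variable R : comNzRingType.
Implicit Types f g : {fps R}.

Lemma fps_fixpoint (Phi : {fps R} -> {fps R}) :
  (forall f g n, (forall k, (k < n)%N -> f k = g k) -> Phi f n = Phi g n) ->
  exists! f, f = Phi f.
Proof.
move=> PhiP; pose it m := iter m Phi 0.
have itS m : it m.+1 = Phi (it m) by [].
have stab n : forall m, (n < m)%N -> it m n = it n.+1 n.
  elim/ltn_ind: n => n IH [//|m] nm; rewrite !itS; apply: PhiP => k kn.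
  by rewrite IH ?(IH k kn n)//; lia.
exists (Fps (fun n => it n.+1 n)); split.
  apply: fpsP => n; apply: (PhiP (it n)) => k kn.
  by rewrite /= stab.
move=> g gE; apply: fpsP => n; elim/ltn_ind: n => n IH.
rewrite gE; apply: (PhiP (it n)) => k kn.
by rewrite -IH//= stab.
Qed.

Lemma coef_fpsD f g n : (f + g) n = f n + g n. Proof. by []. Qed.
Lemma coef_fpsB f g n : (f - g) n = f n - g n. Proof. by []. Qed.
Lemma coef_fps1 n : (1 : {fps R}) n = (n == 0%N)%:R.
Proof. by case: n. Qed.

Lemma coef_fpsXM f n : (fpsX * f) n = if n is m.+1 then f m else 0.
Proof.
rewrite /GRing.mul /=; case: n => [|m]; first by rewrite big_ord1 mul0r.
rewrite big_ord_recl/= mul0r add0r big_ord_recl/= mul1r big1 ?addr0//=.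
  by congr (f _); rewrite /bump /= subn1.
by move=> i _; rewrite mul0r.
Qed.

Lemma coef_fpsM_ext f f' g g' n :
  (forall k, (k <= n)%N -> f k = f' k) -> (forall k, (k <= n)%N -> g k = g' k) ->
  (f * g) n = (f' * g') n.
Proof.
move=> ff gg; rewrite /GRing.mul /=; apply: eq_bigr => i _.
by rewrite ff ?gg//; have := ltn_ord i; lia.
Qed.

End FpsFixpoint.

Lemma exists_unique_X (R : comNzRingType) :
  exists! X : {fps R}, X = fpsX * (2 + X ^+ 3).
Proof.
apply: fps_fixpoint => f g [|n] fg; rewrite !coef_fpsXM//.
have {}fg k : (k <= n)%N -> f k = g k by move=> kn; apply: fg; lia.
suff E : (f ^+ 3) n = (g ^+ 3) n by rewrite !coef_fpsD E.
rewrite !exprS expr0 !mulr1.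
apply: coef_fpsM_ext => // k kn; apply: coef_fpsM_ext => l lk; apply: fg; lia.
Qed.

(* The square root with constant term 1; unspecified if there is none. *)
Definition fps_sqrt (R : comNzRingType) (f : {fps R}) : {fps R} :=
  xget 0 [set s : {fps R} | s ^+ 2 = f /\ s 0%N = 1]%classic.

Lemma fps_sqrt_unique (R : comUnitRingType) (f : {fps R}) :
    (2 : R) \is a GRing.unit -> f 0%N = 1 ->
  exists! s : {fps R}, s ^+ 2 = f /\ s 0%N = 1.
Proof.
move=> u2 f0.
pose h : {fps R} := Fps (fun n => f n.+1).
pose half : {fps R} := fpsC 2^-1.
have half2 : half * 2 = 1.
  apply: fpsP => n; rewrite -[2]/(1 + 1) mulrDr mulr1 coef_fpsD coef_fps1.
  by case: n => [|n] /=; rewrite ?addr0// -[X in X + X]mulr1 -mulrDr mulVr.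
have fE : f = 1 + fpsX * h.
  apply: fpsP => n; rewrite coef_fpsD coef_fps1 coef_fpsXM.
  by case: n => [|n]; rewrite /= ?f0 ?addr0 ?add0r.
have [|u [uE uU]] := @fps_fixpoint R (fun u => half * (h - fpsX * u ^+ 2)).
  move=> v w n vw; apply: coef_fpsM_ext => // k kn.
  rewrite !coef_fpsB !coef_fpsXM; congr (_ - _); case: k kn => // k kn.
  by rewrite !expr2; apply: coef_fpsM_ext => l lk; apply: vw; lia.
have key v : (1 + fpsX * v) ^+ 2 = f <-> v = half * (h - fpsX * v ^+ 2).
  have Xinj (a b : {fps R}) : fpsX * a = fpsX * b -> a = b.
    move=> ab; apply: fpsP => n.
    by have := congr1 (fun c : {fps R} => c n.+1) ab; rewrite !coef_fpsXM.
  have sq : (1 + fpsX * v) ^+ 2 = 1 + fpsX * (2 * v + fpsX * v ^+ 2).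
    rewrite sqrrD expr1n mul1r -addrA; congr (1 + _).
    by rewrite mulrDr exprMn expr2 -mulrA -mulr_natl mulrCA.
  split=> [|vE].
    rewrite sq fE => /addrI /Xinj <-.
    by rewrite addrK mulrA half2 mul1r.
  rewrite sq fE; congr (1 + fpsX * _).
  by rewrite [X in 2 * X]vE mulrA [2 * half]mulrC half2 mul1r subrK.
exists (1 + fpsX * u); split.
  split; first exact/key.
  by rewrite coef_fpsD coef_fps1 coef_fpsXM addr0.
move=> s [s2 s0].
have sE : s = 1 + fpsX * Fps (fun n => s n.+1).
  apply: fpsP => n; rewrite coef_fpsD coef_fps1 coef_fpsXM.
  by case: n => [|n]; rewrite /= ?s0 ?addr0 ?add0r.
by rewrite sE; congr (1 + fpsX * _); apply: uU; apply/key; rewrite -sE.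
Qed.

(* Laurent series: [f k] is the coefficient of the k-th power. *)

Record laurent (R : zmodType) := Laurent {
  laurent_coef :> int -> R ;
  laurent_bounded : exists N : nat, forall k : int, k < - N%:Z -> laurent_coef k = 0
}.

Notation "{ 'laurent' R }" := (laurent R)
  (at level 0, format "{ 'laurent'  R }").

HB.instance Definition _ (R : zmodType) := gen_eqMixin {laurent R}.
HB.instance Definition _ (R : zmodType) := gen_choiceMixin {laurent R}.

Lemma laurentP (R : zmodType) (f g : {laurent R}) : f =1 g -> f = g.
Proof.
case: f g => [f fN] [g gN] /= /funext fg; case: _ / fg gN => gN.
by congr Laurent; apply: Prop_irrelevance.
Qed.

Definition laurent_of_fps (R : zmodType) (f : {fps R}) : {laurent R}.
Proof.
exists (fun k : int => if k is Posz n then f n else 0).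
by exists 0%N => -[].
Defined.

Section LaurentRing.
Variable R : comNzRingType.
Implicit Types f g h : {laurent R}.

Definition vanish (N : nat) (f : int -> R) := forall k : int, k < - N%:Z -> f k = 0.

Lemma vanishW M N f : (M <= N)%N -> vanish M f -> vanish N f.
Proof. by move=> MN fM k kN; apply: fM; lia. Qed.

Definition laurentC (c : R) : {laurent R} := laurent_of_fps (fpsC c).
Definition laurentX : {laurent R} := laurent_of_fps fpsX.

Fact laurent_add_bounded f g : exists N, vanish N (fun k => f k + g k).
Proof.
case: (laurent_bounded f) (laurent_bounded g) => [M fM] [N gN].
by exists (M + N)%N => k kMN; rewrite fM ?gN ?addr0//; lia.
Qed.
Definition laurent_add f g := Laurent (laurent_add_bounded f g).

Fact laurent_opp_bounded f : exists N, vanish N (fun k => - f k).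
Proof.
by case: (laurent_bounded f) => [M fM]; exists M => k /fM ->; rewrite oppr0.
Qed.
Definition laurent_opp f := Laurent (laurent_opp_bounded f).

(* Only finitely many terms are nonzero, since f and g are bounded below. *)
Definition laurent_mul_coef f g (k : int) : R :=
  \sum_(i \in [set: int]%classic) f i * g (k - i).

Definition laurent_shift (N : nat) (f : int -> R) : {fps R} :=
  Fps (fun n => f (n%:Z - N%:Z)).

Lemma laurent_mul_coefE M N f g : vanish M f -> vanish N g -> forall k,
  laurent_mul_coef f g k =
  if k + M%:Z + N%:Z is Posz m
  then (laurent_shift M f * laurent_shift N g) m else 0.
Proof.
move=> fM gN k; rewrite /laurent_mul_coef.
case E : (k + M%:Z + N%:Z) => [m|m]; last first.
  rewrite fsbig1// => i _.
  have [iM|iM] := ltP i (- M%:Z); first by rewrite fM// mul0r.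
  by rewrite gN ?mulr0//; lia.
pose r : seq int := [seq n%:Z - M%:Z | n : nat <- iota 0 m.+1].
have rP (i : int) : - M%:Z <= i -> - N%:Z <= k - i -> i \in r.
  move=> iM iN; have -> : i = `|(i + M%:Z)%R|%N%:Z - M%:Z by lia.
  by apply/mapP; exists `|(i + M%:Z)%R|%N; rewrite ?mem_iota//; lia.
have ur : uniq r by rewrite map_inj_uniq ?iota_uniq// => a b /=; lia.
rewrite (@fsbigE _ _ _ int _ r)//; last first.
  move=> i _ ir; have [iM|iM] := ltP i (- M%:Z); first by rewrite fM// mul0r.
  have [jM|jM] := ltP (k - i) (- N%:Z); first by rewrite [g _]gN// mulr0.
  by rewrite rP in ir.
under eq_bigl do rewrite in_setT.
rewrite big_map -[iota _ _]/(index_iota 0 m.+1) big_mkord.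
apply: eq_bigr => i _ /=; congr (f _ * g _).
by have := ltn_ord i; lia.
Qed.

Lemma laurent_mul_vanish M N f g :
  vanish M f -> vanish N g -> vanish (M + N) (laurent_mul_coef f g).
Proof.
move=> fM gN k kMN; rewrite (laurent_mul_coefE fM gN).
by case E: (_ + _ + _) => [m|//]; lia.
Qed.

Fact laurent_mul_bounded f g : exists N, vanish N (laurent_mul_coef f g).
Proof.
case: (laurent_bounded f) (laurent_bounded g) => [M fM] [N gN].
by exists (M + N)%N; apply: laurent_mul_vanish.
Qed.
Definition laurent_mul f g := Laurent (laurent_mul_bounded f g).

Lemma laurent_shift_mul M N f g : vanish M f -> vanish N g ->
  laurent_shift (M + N) (laurent_mul f g) =
  laurent_shift M f * laurent_shift N g.
Proof.
move=> fM gN; apply: fpsP => n /=; rewrite (laurent_mul_coefE fM gN).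
by have -> : n%:Z - (M + N)%:Z + M%:Z + N%:Z = n by lia.
Qed.

Lemma laurent_shift_inj N f g : vanish N f -> vanish N g ->
  laurent_shift N f = laurent_shift N g -> f = g.
Proof.
move=> fN gN fg; apply: laurentP => k.
have [kN|kN] := ltP k (- N%:Z); first by rewrite fN ?gN.
have := congr1 (fun u : {fps R} => u `|(k + N%:Z)%R|%N) fg => /=.
by have -> : `|(k + N%:Z)%R|%N%:Z - N%:Z = k by lia.
Qed.

Fact laurent_addA : associative laurent_add.
Proof. by move=> f g h; apply: laurentP => k /=; rewrite addrA. Qed.
Fact laurent_addC : commutative laurent_add.
Proof. by move=> f g; apply: laurentP => k /=; rewrite addrC. Qed.
Fact laurent_add0 : left_id (laurentC 0) laurent_add.
Proof.
by move=> f; apply: laurentP => -[] k /=; rewrite ?if_same add0r.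
Qed.
Fact laurent_addN : left_inverse (laurentC 0) laurent_opp laurent_add.
Proof.
by move=> f; apply: laurentP => -[] k /=; rewrite ?if_same addNr.
Qed.

HB.instance Definition _ := GRing.isZmodule.Build {laurent R}
  laurent_addA laurent_addC laurent_add0 laurent_addN.

Fact laurent_mulA : associative laurent_mul.
Proof.
move=> f g h; case: (laurent_bounded f) => M fM.
case: (laurent_bounded g) (laurent_bounded h) => [N gN] [P hP].
have fg : vanish (M + N) (laurent_mul f g) by apply: laurent_mul_vanish.
have gh : vanish (N + P) (laurent_mul g h) by apply: laurent_mul_vanish.
apply: (@laurent_shift_inj (M + (N + P))).
- exact: (laurent_mul_vanish fM gh).
- rewrite addnA; exact: (laurent_mul_vanish fg hP).
rewrite (laurent_shift_mul fM gh) (laurent_shift_mul gN hP) addnA.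
by rewrite (laurent_shift_mul fg hP) (laurent_shift_mul fM gN) mulrA.
Qed.

Fact laurent_mulC : commutative laurent_mul.
Proof.
move=> f g; case: (laurent_bounded f) (laurent_bounded g) => [M fM] [N gN].
apply: (@laurent_shift_inj (M + N)); first exact: laurent_mul_vanish.
  rewrite addnC; exact: laurent_mul_vanish.
by rewrite (laurent_shift_mul fM gN) addnC (laurent_shift_mul gN fM) mulrC.
Qed.

Fact laurent_mul1 : left_id (laurentC 1) laurent_mul.
Proof.
move=> f; case: (laurent_bounded f) => M fM.
have v1 : vanish 0 (laurentC 1) by case.
apply: (@laurent_shift_inj (0 + M)) => //; first exact: laurent_mul_vanish.
rewrite (laurent_shift_mul v1 fM) -[RHS]mul1r; congr (_ * _).
apply: fpsP => n; rewrite [LHS]/(laurentC 1 (n%:Z - 0%N%:Z)).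
by have -> : n%:Z - 0%N%:Z = n%:Z by lia.
Qed.

Fact laurent_mulDl : left_distributive laurent_mul laurent_add.
Proof.
move=> f g h; case: (laurent_bounded f) => M fM.
case: (laurent_bounded g) (laurent_bounded h) => [N gN] [P hP].
have {}fM : vanish (M + N) f by apply: vanishW fM; lia.
have {}gN : vanish (M + N) g by apply: vanishW gN; lia.
have fgMN : vanish (M + N) (laurent_add f g).
  by move=> k kMN /=; rewrite fM ?gN ?addr0.
apply: (@laurent_shift_inj (M + N + P)).
- exact: (laurent_mul_vanish fgMN hP).
- move=> k kMN /=; rewrite (laurent_mul_vanish fM hP)//.
  by rewrite (laurent_mul_vanish gN hP)// addr0.
rewrite (laurent_shift_mul fgMN hP).
transitivity (laurent_shift (M + N + P) (laurent_mul f h) +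
              laurent_shift (M + N + P) (laurent_mul g h)); last exact: fpsP.
rewrite (laurent_shift_mul fM hP) (laurent_shift_mul gN hP) -mulrDl.
by congr (_ * _); apply: fpsP.
Qed.

Fact laurent_1neq0 : laurentC 1 != 0.
Proof.
by apply/eqP => /(congr1 (fun f : {laurent R} => f 0)) /eqP; rewrite oner_eq0.
Qed.

HB.instance Definition _ := GRing.Zmodule_isComNzRing.Build {laurent R}
  laurent_mulA laurent_mulC laurent_mul1 laurent_mulDl laurent_1neq0.

Definition laurent_unit : {pred {laurent R}} :=
  fun f => `[< exists g, g * f = 1 >].
Definition laurent_inv f : {laurent R} :=
  if pselect (exists g, g * f = 1) is left fV then sval (cid fV) else f.

Fact laurent_mulVr : {in laurent_unit, left_inverse 1 laurent_inv *%R}.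
Proof.
move=> f /asboolP fV; rewrite /laurent_inv; case: pselect => // {}fV.
by case: cid.
Qed.
Fact laurent_unitP f g : g * f = 1 -> laurent_unit f.
Proof. by move=> gf; apply/asboolP; exists g. Qed.
Fact laurent_inv_out : {in [predC laurent_unit], laurent_inv =1 id}.
Proof.
by move=> f /asboolPn fV; rewrite /laurent_inv; case: pselect.
Qed.

HB.instance Definition _ := GRing.ComNzRing_hasMulInverse.Build {laurent R}
  laurent_mulVr laurent_unitP laurent_inv_out.

(* Laurent polynomials: the Laurent series that are also bounded above. *)

Definition lpoly_pred : {pred {laurent R}} :=
  fun f => `[< exists N : nat, forall k : int, N%:Z < k -> f k = 0 >].

Fact lpoly_subring_closed : subring_closed lpoly_pred.
Proof.
split.
- by apply/asboolP; exists 0%N => -[[|n]|n].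
- move=> f g /asboolP[M fM] /asboolP[N gN]; apply/asboolP; exists (M + N)%N => k kMN.
  rewrite /GRing.add /GRing.opp /= fM ?gN ?oppr0 ?addr0//; lia.
- move=> f g /asboolP[M fM] /asboolP[N gN]; apply/asboolP; exists (M + N)%N => k kMN.
  rewrite /GRing.mul /= /laurent_mul_coef fsbig1// => i _.
  have [iM|iM] := ltP M%:Z i; first by rewrite fM// mul0r.
  by rewrite gN ?mulr0//; lia.
Qed.

Record lpoly := LPoly {
  lpoly_val :> {laurent R} ; _ : lpoly_val \in lpoly_pred
}.

HB.instance Definition _ := [isSub for lpoly_val].
HB.instance Definition _ := [Choice of lpoly by <:].
HB.instance Definition _ :=
  GRing.isSubringClosed.Build {laurent R} lpoly_pred lpoly_subring_closed.
HB.instance Definition _ := [SubChoice_isSubComNzRing of lpoly by <:].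

Fact lpoly_of_poly_subproof (p : {poly R}) :
  laurent_of_fps (Fps (fun n => p`_n)) \in lpoly_pred.
Proof.
apply/asboolP; exists (size p) => -[n|n]//= pn.
by rewrite nth_default//; lia.
Qed.
Definition lpoly_of_poly p : lpoly := LPoly (lpoly_of_poly_subproof p).

End LaurentRing.

Arguments laurentX {R}.

Notation "{ 'lpoly' R }" := (lpoly R) (at level 0, format "{ 'lpoly'  R }").

(* The inclusion of the ring Q[x][[t]] in Q[x,1/x]((t)). *)
Definition emb (F : {fps {poly rat}}) : {laurent {lpoly rat}} :=
  laurent_of_fps (fps_map (@lpoly_of_poly rat) F).

Definition kreweras_steps : seq (int * int) := [:: (0, -1); (-1, 0); (1, 1)].

(* A walk is the sequence of its n+1 vertices. *)
Definition walks (i j n : nat) : set (seq (int * int)) :=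
  [set w : seq (int * int) |
    [/\ size w = n.+1,
        w`_0 = (0, 0),
        w`_n = (i%:Z, j%:Z),
        forall k, (k < n)%N -> w`_k.+1 - w`_k \in kreweras_steps
      & forall k, (k <= n)%N -> 0 <= (w`_k).1 /\ 0 <= (w`_k).2]]%classic.

Definition nwalks (i j n : nat) : nat := #|` fset_set (walks i j n)|.

Lemma finite_walks i j n : finite_set (walks i j n).
Proof.
pose st (a : 'I_3) := kreweras_steps`_a.
pose W (s : n.-tuple 'I_3) : seq (int * int) :=
  mkseq (fun k => \sum_(l < k) (st (nth ord0 s l))) n.+1.
apply: (@sub_finite_set _ _ (W @` setT)%classic); last exact/finite_image/finite_finset.
move=> w [ws w0 _ wst _].
have sP k : exists a : 'I_3, (k < n)%N -> w`_k.+1 - w`_k = st a.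
  have [kn|nk] := ltnP k n; last by exists ord0.
  have := wst k kn; rewrite -index_mem => a3.
  by exists (Ordinal a3) => _; rewrite /st /= nth_index// -index_mem.
have [s sE] := choice sP.
exists (mktuple (fun l : 'I_n => s l)) => //.
apply: (@eq_from_nth _ 0); first by rewrite size_mkseq ws.
move=> k; rewrite size_mkseq => kn; rewrite nth_mkseq//.
elim: k kn => [|k IH] kn; first by rewrite big_ord0 w0.
rewrite big_ord_recr [nat_of_ord ord_max]/= IH; last by lia.
have kn' : (k < n)%N by lia.
have -> : nth ord0 (mktuple (fun l : 'I_n => s l)) k = s k.
  by rewrite -[k in LHS]/(val (Ordinal kn')) -tnth_nth tnth_mktuple.
by rewrite -sE// [LHS]addrC subrK.
Qed.

Lemma nwalks_eq0 i j n : (n < i)%N || (n < j)%N -> nwalks i j n = 0%N.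
Proof.
move=> nij; rewrite /nwalks; suff -> : walks i j n = set0%classic.
  by rewrite fset_set0 cardfs0.
apply/seteqP; split=> // w [_ w0 wn wst _].
have H k : (k <= n)%N -> (w`_k).1 <= k%:Z /\ (w`_k).2 <= k%:Z.
  elim: k => [|k IH] kn; first by rewrite w0.
  have [] := IH (ltnW kn); have := wst k kn; rewrite !inE.
  case: (w`_k) (w`_k.+1) => [a b] [c d] /=.
  by move=> /or3P[] /eqP[] *; lia.
by have := H n (leqnn n); rewrite wn /=; lia.
Qed.

(* The generating function Q(x,y;t), as a power series in t over Q[x][y]. The
   sums over i and j are cut at n, which loses nothing: see [coef_Qxy]. *)
Definition Qxy : {fps {poly {poly rat}}} :=
  Fps (fun n => \poly_(j < n.+1) \poly_(i < n.+1) (nwalks i j n)%:R).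

Lemma coef_Qxy i j n : (Qxy n)`_j`_i = (nwalks i j n)%:R.
Proof.
rewrite /= coef_poly; case: ltnP => nj; last by rewrite coef0 nwalks_eq0 ?nj ?orbT.
by rewrite coef_poly; case: ltnP => // ni; rewrite nwalks_eq0 ?ni.
Qed.

Definition Qx0 : {fps {poly rat}} :=
  fps_map (fun p : {poly {poly rat}} => p.[0]) Qxy.

Definition catalan (i : nat) : rat := (i.+1)%:R^-1 * 'C(2 * i, i)%:R.

(* Main.v *)
Require Import Defs.
From mathcomp Require Import all_boot all_order all_algebra.
From HB Require Import structures.
From mathcomp Require Import finmap boolp classical_sets functions cardinality.
From mathcomp Require Import zify ring lra.

Import Order.TTheory GRing.Theory Num.Theory.
Local Open Scope ring_scope.

Set Implicit Arguments.
Unset Strict Implicit.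
Unset Printing Implicit Defensive.

(* Write R(x) = Q(x,0). Since Q is symmetric in x and y, removing the last step
   of a walk gives
     (xy - t(x + y + x^2 y^2)) Q(x,y) = xy - t x R(x) - t y R(y).
   Put t = x s and let Y be the power series in s over Q[x] with
   Y = s (x + Y + x^2 Y^2). Then y := Y cancels the kernel, so that
     Y = s (x R(x) + Y R(Y)),
   and this determines R, because Y is divisible by s.
   It remains to see that the claimed series satisfies this equation. With
   Z(x) = (1/X - 1/x) sqrt(1 - x X^2) the equation says Z(x) + Z(Y) = 0. Now
     Z(x)^2 = 1/X^2 + 2X - (1/t)/x + 1/x^2 - x,
   which takes the same value at Y since 1/t = 1/x + 1/Y + xY, and the lowest
   order terms show that Z(x) <> Z(Y).
   The coefficients are found by expanding the square root with the Catalan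
   series and by Lagrange inversion for F = 1 + c z^q F^p. *)

(** * Coefficients and orders of sums, products and powers of series *)

Section FpsCoef.
Variable R : comNzRingType.
Implicit Types f g h : {fps R}.

Lemma coef_fps0 n : (0 : {fps R}) n = 0.
Proof. by rewrite /= if_same. Qed.

Lemma coef_fpsM f g n : (f * g) n = \sum_(i < n.+1) f i * g (n - i)%N.
Proof. by []. Qed.

Lemma coef_fps_sum (I : Type) (r : seq I) (P : pred I) (F : I -> {fps R}) n :
  (\sum_(i <- r | P i) F i) n = \sum_(i <- r | P i) F i n.
Proof. by apply: (big_morph (fun f : {fps R} => f n)) => //; exact: coef_fps0. Qed.

Lemma coef_fpsCM c f n : (fpsC c * f) n = c * f n.
Proof.
rewrite coef_fpsM big_ord_recl subn0 big1 ?addr0// => i _.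
by rewrite /= mul0r.
Qed.

Lemma coef_fpsM_lt f g a b k :
    (forall k, (k < a)%N -> f k = 0) -> (forall k, (k < b)%N -> g k = 0) ->
  (k < a + b)%N -> (f * g) k = 0.
Proof.
move=> fa gb kab; rewrite coef_fpsM big1// => i _.
have [ia|ia] := ltnP i a; first by rewrite fa// mul0r.
by rewrite gb ?mulr0//; have := ltn_ord i; lia.
Qed.

Lemma coef_fpsM_low f g a b :
    (forall k, (k < a)%N -> f k = 0) -> (forall k, (k < b)%N -> g k = 0) ->
  (f * g) (a + b)%N = f a * g b.
Proof.
move=> fa gb; have ai : (a < (a + b).+1)%N by lia.
rewrite coef_fpsM (bigD1 (Ordinal ai))//= addKn big1 ?addr0// => i /eqP ia.
have [ltia|leai] := ltnP i a; first by rewrite fa// mul0r.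
have neai : a != i by apply/eqP=> ai'; apply: ia; exact: val_inj.
by rewrite gb ?mulr0//; have := ltn_ord i; lia.
Qed.

Lemma coef_fpsM0 f g : (f * g) 0%N = f 0%N * g 0%N.
Proof. exact: (@coef_fpsM_low f g 0 0). Qed.

Lemma coef_fpsX0 f n : (f ^+ n) 0%N = f 0%N ^+ n.
Proof.
by elim: n => [|n IH]; rewrite ?expr0 ?coef_fps1// !exprS coef_fpsM0 IH.
Qed.

Lemma coef_fpsX_lt f n k : f 0%N = 0 -> (k < n)%N -> (f ^+ n) k = 0.
Proof.
move=> f0; elim: n k => [//|n IH] k kn; rewrite exprS.
by apply: (@coef_fpsM_lt _ _ 1 n) => // -[].
Qed.

Lemma coef_fpsX_low f n : f 0%N = 0 -> (f ^+ n) n = f 1%N ^+ n.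
Proof.
move=> f0; elim: n => [|n IH]; first by rewrite !expr0 coef_fps1.
rewrite !exprS -IH -(@coef_fpsM_low f (f ^+ n) 1 n)//; first by case.
by move=> k; exact: coef_fpsX_lt.
Qed.

Lemma fpsXI f g : fpsX * f = fpsX * g -> f = g.
Proof.
move=> fg; apply: fpsP => n.
by have := congr1 (fun h : {fps R} => h n.+1) fg; rewrite !coef_fpsXM.
Qed.

Lemma coef_fpsXnM f k n :
  (fpsX ^+ k * f) n = if (k <= n)%N then f (n - k)%N else 0.
Proof.
elim: k n => [|k IH] n; first by rewrite mul1r subn0.
by rewrite exprS -mulrA coef_fpsXM; case: n => // n; rewrite IH ltnS subSS.
Qed.

Fact fpsC_is_zmod_morphism : zmod_morphism (@fpsC R).
Proof. by move=> a b; apply: fpsP => -[|n] //=; rewrite subr0. Qed.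
Fact fpsC_is_monoid_morphism : monoid_morphism (@fpsC R).
Proof.
by split=> // a b; apply: fpsP => n; rewrite coef_fpsCM /=; case: eqP; rewrite ?mulr0.
Qed.
HB.instance Definition _ := GRing.isZmodMorphism.Build R {fps R} (@fpsC R)
  fpsC_is_zmod_morphism.
HB.instance Definition _ := GRing.isMonoidMorphism.Build R {fps R} (@fpsC R)
  fpsC_is_monoid_morphism.

End FpsCoef.

(** With [a] the order of [f], coefficient [a + m] of [f * (g - h)] is [f a] times coefficient [m]
    of [g - h] as soon as the earlier ones vanish. A single nonzero coefficient, at any index,
    serves as the certificate that [f] is not zero. *)
Lemma fps_mulfI (R : idomainType) (f g h : {fps R}) n :
  f n != 0 -> f * g = f * h -> g = h.
Proof.
move=> fn /eqP; rewrite -subr_eq0 -mulrBr => /eqP fgh; apply/eqP.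
rewrite -subr_eq0; apply/eqP; move: (g - h) fgh => {g h} g fg0.
have fex : exists n, f n != 0 by exists n.
have [a fa amin] := ex_minnP fex.
have fa0 k : (k < a)%N -> f k = 0.
  by move=> ka; apply/eqP; apply: contraLR ka => /amin; rewrite -leqNgt.
apply: fpsP => m; rewrite coef_fps0; elim/ltn_ind: m => m IH.
have := coef_fpsM_low fa0 IH; rewrite fg0 coef_fps0 => /esym/eqP.
by rewrite mulf_eq0 (negPf fa) => /eqP.
Qed.

Section FpsMap.
Variables (R S : comNzRingType) (phi : {rmorphism R -> S}).

Fact fps_map_is_zmod_morphism : zmod_morphism (fps_map phi).
Proof. by move=> f g; apply: fpsP => n /=; rewrite rmorphB. Qed.
Fact fps_map_is_monoid_morphism : monoid_morphism (fps_map phi).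
Proof.
split; first by apply: fpsP => -[|n] /=; rewrite ?rmorph1 ?rmorph0.
move=> f g; apply: fpsP => n; rewrite coef_fpsM /= rmorph_sum.
by apply: eq_bigr => i _; rewrite rmorphM.
Qed.
HB.instance Definition _ := GRing.isZmodMorphism.Build {fps R} {fps S}
  (fps_map phi) fps_map_is_zmod_morphism.
HB.instance Definition _ := GRing.isMonoidMorphism.Build {fps R} {fps S}
  (fps_map phi) fps_map_is_monoid_morphism.

Lemma fps_mapX : fps_map phi fpsX = fpsX.
Proof. by apply: fpsP => n /=; rewrite rmorph_nat. Qed.

Lemma fps_mapC c : fps_map phi (fpsC c) = fpsC (phi c).
Proof. by apply: fpsP => -[|n] //=; rewrite rmorph0. Qed.

End FpsMap.

(** * Substitution of a series without constant term, the coefficients being themselves mapped to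
    series *)

Section FpsSubst.
Variables (R S : comNzRingType) (phi : {rmorphism R -> {fps S}}).
Variables (tau : {fps S}) (tau0 : tau 0%N = 0).
Implicit Types f g : {fps R}.

(* The sum of the series \sum_n phi (f n) * tau ^+ n; the terms with n > m do not
   contribute to the coefficient m. *)
Definition fps_subst (_ : tau 0%N = 0) f : {fps S} :=
  Fps (fun m => (map_poly phi (fps_trunc m f)).[tau] m).

Local Notation sigma := (fps_subst tau0).

(** Since [tau ^+ i] has order at least [i], the terms beyond degree [m] do not matter. This freedom
    in the choice of [p] reduces the ring morphism laws to those of polynomial evaluation. *)
Lemma fps_substE f (p : {poly R}) m :
  (forall i, (i <= m)%N -> p`_i = f i) -> sigma f m = (map_poly phi p).[tau] m.
Proof.
move=> pf /=; apply/eqP; rewrite -subr_eq0 -coef_fpsB -hornerN -hornerD -rmorphB.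
set q := _ - p; have q0 i : (i <= m)%N -> q`_i = 0.
  by move=> im; rewrite coefB coef_fps_trunc// pf// subrr.
rewrite horner_coef coef_fps_sum big1// => i _.
rewrite coef_map; have [im|mi] := leqP i m.
  by rewrite q0// raddf0 mul0r coef_fps0.
by apply: (@coef_fpsM_lt _ _ _ 0 i) => // k; exact: coef_fpsX_lt.
Qed.

Fact fps_subst_is_zmod_morphism : zmod_morphism sigma.
Proof.
move=> f g; apply: fpsP => m.
rewrite (@fps_substE _ (fps_trunc m f - fps_trunc m g)).
  by rewrite rmorphB hornerD hornerN.
by move=> i im; rewrite coefB !coef_fps_trunc.
Qed.
Fact fps_subst_is_monoid_morphism : monoid_morphism sigma.
Proof.
split.
  apply: fpsP => m; rewrite (@fps_substE _ 1) ?rmorph1 ?hornerC// => i _.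
  by rewrite coef1 coef_fps1.
move=> f g; apply: fpsP => m.
rewrite (@fps_substE _ (fps_trunc m f * fps_trunc m g)).
  rewrite rmorphM hornerM; apply: coef_fpsM_ext => k km; apply/esym/fps_substE => i ik;
  by rewrite coef_fps_trunc//; lia.
by apply: fps_mulE => i im; rewrite coef_fps_trunc.
Qed.
HB.instance Definition _ := GRing.isZmodMorphism.Build {fps R} {fps S}
  sigma fps_subst_is_zmod_morphism.
HB.instance Definition _ := GRing.isMonoidMorphism.Build {fps R} {fps S}
  sigma fps_subst_is_monoid_morphism.

Lemma fps_substC c : sigma (fpsC c) = phi c.
Proof.
apply: fpsP => m; rewrite (@fps_substE _ c%:P) ?map_polyC ?hornerC// => i _.
by rewrite coefC.
Qed.

Lemma fps_substX : sigma fpsX = tau.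
Proof.
apply: fpsP => m; rewrite (@fps_substE _ 'X) ?map_polyX ?hornerX// => i _.
by rewrite coefX.
Qed.

Lemma fps_subst_lt f n m :
  (forall k, (k < n)%N -> f k = 0) -> (m < n)%N -> sigma f m = 0.
Proof.
move=> fn mn; rewrite (@fps_substE _ 0) ?rmorph0 ?horner0 ?coef_fps0// => i im.
by rewrite coef0 fn//; lia.
Qed.

Lemma fps_subst_low f n : (forall k, (k < n)%N -> f k = 0) ->
  sigma f n = phi (f n) 0%N * tau 1%N ^+ n.
Proof.
move=> fn; rewrite (@fps_substE _ ((f n)%:P * 'X^n)).
  rewrite rmorphM /= map_polyC map_polyXn hornerM hornerC hornerXn.
  rewrite -coef_fpsX_low//; apply: (@coef_fpsM_low _ _ _ 0 n) => // k.
  exact: coef_fpsX_lt.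
move=> i; rewrite coefCM coefXn; case: ltngtP => // [/fn->|->] _; last by rewrite mulr1.
by rewrite mulr0.
Qed.

End FpsSubst.

(** * Lagrange inversion and the Catalan series *)

(* The coefficient k/(pn+k) 'C(pn+k, n) of Lagrange inversion, in a form that is
   also correct for k = 0 (see [raneyE]). *)
Definition raney p k n : rat :=
  if n is m.+1 then k%:R / n%:R * 'C(p * n + k - 1, m)%:R else 1.

(** This is the recurrence that [F ^+ k.+1 = F ^+ k + c z^q F ^+ (k + p.+1)] imposes on
    coefficients. All binomials have upper index [N] or [N.+1], so Pascal's rule and the ratio of
    ['C(N, m.+1)] to ['C(N, m)] suffice. *)
Lemma raneyS p k n :
  raney p.+1 k.+1 n.+1 = raney p.+1 k n.+1 + raney p.+1 (k + p.+1) n.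
Proof.
case: n => [|m]; rewrite /raney; first by rewrite !bin0 !mulr1n !divr1 natr1.
have -> : (p.+1 * m.+1 + (k + p.+1) - 1 = p.+1 * m.+2 + k - 1)%N by lia.
have -> : (p.+1 * m.+2 + k.+1 - 1 = (p.+1 * m.+2 + k - 1).+1)%N by lia.
set N := (p.+1 * m.+2 + k - 1)%N; rewrite binS natrD.
have /(congr1 (fun n => n%:R : rat)) := mul_bin_left N m.
have mN : (m <= N)%N by rewrite /N; lia.
rewrite !natrM natrB//.
have -> : N%:R = p.+1%:R * m.+2%:R + k%:R - 1 :> rat.
  by rewrite /N natrB ?natrD ?natrM//; lia.
move: ('C(N, m.+1)%:R : rat) ('C(N, m)%:R : rat) => u v.
have m1 : m%:R + 1 != 0 :> rat by rewrite natr1 pnatr_eq0.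
have m2 : m%:R + 1 + 1 != 0 :> rat by rewrite !natr1 pnatr_eq0.
rewrite natrD -!natr1 => E.
have -> : u = ((p%:R + 1) * (m%:R + 1 + 1) + k%:R - 1 - m%:R) * v / (m%:R + 1).
  by rewrite -E mulrAC mulfV ?mul1r.
by field; rewrite m1 m2.
Qed.

(** Induction on [n], then on [k]: expanding one factor of [F ^+ k.+1] by its equation leaves
    [F ^+ k] at the same index and [F ^+ (k + p.+1)] at the previous multiple of [q.+1]. *)
Lemma coef_fuss_catalan p q (c : rat) (F : {fps rat}) :
    F = 1 + fpsC c * fpsX ^+ q.+1 * F ^+ p.+1 ->
  forall n k, (F ^+ k) (q.+1 * n)%N = c ^+ n * raney p.+1 k n.
Proof.
move=> FE; elim=> [|n IHn]; elim=> [|k IHk].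
- by rewrite muln0 expr0 coef_fps1 mulr1.
- rewrite exprS {1}FE mulrDl mul1r coef_fpsD IHk muln0.
  by rewrite -!mulrA coef_fpsCM coef_fpsXnM mulr0 addr0.
- by rewrite expr0 coef_fps1 mulnS /= !mul0r mulr0.
rewrite exprS {1}FE mulrDl mul1r coef_fpsD IHk.
rewrite -!mulrA coef_fpsCM coef_fpsXnM mulnS leq_addr addKn -exprD addnC IHn.
by rewrite raneyS mulrDr !exprS -!mulrA.
Qed.

Lemma catalan_raney n : catalan n = raney 2 1 n.
Proof.
case: n => [|m]; first by rewrite /catalan bin0 invr1 mulr1.
rewrite /catalan /raney addnK.
have /(congr1 (fun n => n%:R : rat)) := mul_bin_left (2 * m.+1) m.
have -> : (2 * m.+1 - m = m.+2)%N by lia.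
rewrite !natrM mul1r => E; apply: (mulfI (_ : m.+1%:R != 0)); first by rewrite pnatr_eq0.
apply: (mulfI (_ : m.+2%:R != 0)); first by rewrite pnatr_eq0.
rewrite [X in _ = _ * X]mulrA mulfV ?pnatr_eq0// mul1r -E.
by rewrite mulrCA [X in _ * X]mulrA mulfV ?pnatr_eq0// mul1r.
Qed.

Definition catalan_fps : {fps rat} := Fps catalan.

(** Segner's convolution is not summed directly: the equation has a solution, whose coefficients
    [raney 2 1 n] are then recognised as the Catalan numbers. *)
Lemma catalan_fpsE : catalan_fps = 1 + fpsX * catalan_fps ^+ 2.
Proof.
have [|F [FE _]] := @fps_fixpoint rat (fun F => 1 + fpsX * F ^+ 2).
  move=> f g n fg; rewrite !coef_fpsD !coef_fpsXM; case: n fg => // n fg.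
  by rewrite !expr2; congr (_ + _); apply: coef_fpsM_ext => k kn; apply: fg.
suff -> : catalan_fps = F by [].
have FE1 : F = 1 + fpsC 1 * fpsX ^+ 1 * F ^+ 2 by rewrite rmorph1 mul1r expr1.
apply: fpsP => n; have := coef_fuss_catalan FE1 n 1.
by rewrite mul1n !expr1 expr1n mul1r => ->; rewrite /= catalan_raney.
Qed.

Lemma coef_catalan_fps_sqr n : (catalan_fps ^+ 2) n = catalan n.+1.
Proof.
rewrite -[RHS]/(catalan_fps n.+1) [in RHS]catalan_fpsE.
by rewrite coef_fpsD coef_fps1 coef_fpsXM add0r.
Qed.

(** * Inverses of integers, square roots, and extraction of powers of x *)

Lemma rmorph_natV (F : numFieldType) (R : nzRingType) (f : {rmorphism F -> R}) n :
  f n.+1%:R^-1 * n.+1%:R = 1.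
Proof. by rewrite -(rmorph_nat f) -rmorphM mulVf ?pnatr_eq0// rmorph1. Qed.

Lemma fps_sqrt_eq (R : comUnitRingType) (s : {fps R}) :
  (2 : R) \is a GRing.unit -> s 0%N = 1 -> fps_sqrt (s ^+ 2) = s.
Proof.
move=> u2 s0; have f0 : (s ^+ 2) 0%N = 1 by rewrite coef_fpsX0 s0 expr1n.
have [r [rP rU]] := fps_sqrt_unique u2 f0.
by apply: xget_unique => [|y yP]; last rewrite -(rU y yP) -(rU s).
Qed.

Section XCoef.
Variable R : comNzRingType.

Definition xcoef i (F : {fps {poly R}}) : {fps R} := fps_map (coefp i) F.

Fact xcoef_is_zmod_morphism i : zmod_morphism (xcoef i).
Proof. by move=> f g; apply: fpsP => n; rewrite /= coefB. Qed.
HB.instance Definition _ i := GRing.isZmodMorphism.Build {fps {poly R}} {fps R}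
  (xcoef i) (xcoef_is_zmod_morphism i).

Lemma xcoefCM i f F : xcoef i (fps_map polyC f * F) = f * xcoef i F.
Proof.
apply: fpsP => n; rewrite coef_fpsM /= coef_sum.
by apply: eq_bigr => k _; rewrite coefCM.
Qed.

(** In [f(x h)] the power [x^k] occurs only together with [h ^+ k]. *)
Lemma xcoef_subst (h : {fps R})
    (tau0 : (fpsC 'X * fps_map polyC h : {fps {poly R}}) 0%N = 0) i f :
  h 0%N = 0 ->
  xcoef i (fps_subst (@fpsC {poly R} \o polyC) tau0 f) = fpsC (f i) * h ^+ i.
Proof.
move=> h0; apply: fpsP => n; rewrite coef_fpsCM /=.
rewrite (@horner_coef_wide _ n.+1); last first.
  by rewrite (leq_trans (size_poly _ _))// size_poly.
rewrite coef_fps_sum coef_sum.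
have E (k : 'I_n.+1) :
  (((map_poly (@fpsC {poly R} \o polyC) (fps_trunc n f))`_k *
    (fpsC 'X * fps_map polyC h) ^+ k) n)`_i = (i == k)%:R * (f k * (h ^+ k) n).
  have kn : (k <= n)%N by rewrite -ltnS.
  rewrite coef_map coef_fps_trunc// exprMn -!rmorphXn.
  rewrite (@coef_fpsCM _ (f k)%:P) coef_fpsCM /=.
  by rewrite coefCM coefMC coefXn mulrCA.
under eq_bigr do rewrite E.
(* If [n < i], the index [i] lies beyond the truncation, and [h ^+ i] has no term of degree [n]
   either. *)
have [ni|ni] := ltnP n i.
  rewrite coef_fpsX_lt// mulr0 big1// => k _.
  by have [ik|] := eqVneq i k; [have := ltn_ord k; lia | rewrite mul0r].
rewrite (bigD1 (Ordinal (ni : (i < n.+1)%N)))//= eqxx mul1r big1 ?addr0// => k /eqP kE.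
by have [ik|] := eqVneq i k; [case: kE; exact/val_inj | rewrite mul0r].
Qed.

End XCoef.

(** * The claimed series as a power series in t over Q[x] *)

Section Candidate.
Variables (X : {fps rat}) (X_eq : X = fpsX * (2 + X ^+ 3)).

Let Xx : {fps {poly rat}} := fps_map polyC X.
Let h : {fps rat} := fpsC 4^-1 * X ^+ 2.
Let tau : {fps {poly rat}} := fpsC 'X * fps_map polyC h.

Lemma X_coef0 : X 0%N = 0.
Proof. by rewrite X_eq coef_fpsXM. Qed.

Let h0 : h 0%N = 0.
Proof. by rewrite /h coef_fpsCM coef_fpsX0 X_coef0 expr0n mulr0. Qed.

Let tau0 : tau 0%N = 0.
Proof. by rewrite /tau coef_fpsCM -[fps_map _ _ _]/((h 0%N)%:P) h0 rmorph0 mulr0. Qed.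

Let CC := fps_subst (@fpsC {poly rat} \o polyC) tau0 catalan_fps.

Let CC_eq : CC = 1 + tau * CC ^+ 2.
Proof. by rewrite {1}/CC catalan_fpsE rmorphD rmorphM rmorphXn rmorph1 /= fps_substX. Qed.

(* The claimed series for Q(x,0;t), rationalised by means of
   sqrt(1 - xX^2) = 1 - 2 tau C(tau), where tau = xX^2/4 and C is the Catalan
   series. *)
Definition Qx0_candidate : {fps {poly rat}} :=
  fps_map polyC (fpsC 2^-1 * (2 + X ^+ 3)) *
  (CC - fps_map polyC (fpsC 4^-1 * X ^+ 3) * CC ^+ 2).

Let four : fps_map polyC (fpsC 4^-1) * 4 = 1 :> {fps {poly rat}}.
Proof. exact: (rmorph_natV (fps_map (@polyC rat) \o @fpsC rat) 3). Qed.

Let two : fps_map polyC (fpsC 2^-1) * 2 = 1 :> {fps {poly rat}}.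
Proof. exact: (rmorph_natV (fps_map (@polyC rat) \o @fpsC rat) 1). Qed.

Let Xx_eq : fpsX * (2 + Xx ^+ 3) = Xx.
Proof.
have := congr1 (fps_map (@polyC rat)) X_eq.
by rewrite rmorphM rmorphD rmorphXn rmorph_nat /= fps_mapX -/Xx => <-.
Qed.

Let tauE : tau * 4 = fpsC 'X * Xx ^+ 2.
Proof.
rewrite /tau /h rmorphM rmorphXn /= -/Xx -[RHS]mulr1 -[in RHS]four.
by move: (fps_map polyC _) => q; ring.
Qed.

(** With [C = 1 + tau C^2], the square of [1 - 2 tau C] is [1 - 4 tau (C - tau C^2) = 1 - 4 tau]. *)
Lemma sqrt_candidate : fps_sqrt (1 - fpsC 'X * Xx ^+ 2) = 1 - 2 * tau * CC.
Proof.
have -> : 1 - fpsC 'X * Xx ^+ 2 = (1 - 2 * tau * CC) ^+ 2.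
  have CE : CC - tau * CC ^+ 2 = 1 by rewrite {1}CC_eq addrK.
  rewrite -tauE -[tau * 4]mulr1 -[in X in _ * X]CE.
  by move: tau CC => T C; ring.
apply: fps_sqrt_eq.
  by rewrite -(rmorph_nat (@polyC rat)); apply: rmorph_unit; rewrite unitfE.
by rewrite coef_fpsB coef_fps1 [2 * tau]mulrC -mulrA coef_fpsM0 tau0 mul0r subr0.
Qed.

(** The claimed formula multiplied by [2 t x^2 X], with [X / t] replaced by [2 + X^3]. Free of
    denominators, it can be transported along any ring morphism. *)
Lemma Qx0_candidate_eq : let S := fps_sqrt (1 - fpsC 'X * Xx ^+ 2) in
  2 * fpsX * fpsC 'X ^+ 2 * Xx * Qx0_candidate =
  fpsC 'X * (2 + Xx ^+ 3) - 2 * Xx - 2 * (fpsC 'X - Xx) * S.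
Proof.
rewrite /= sqrt_candidate /Qx0_candidate; move: Xx_eq tauE CC_eq two four.
rewrite (rmorphM _ (fpsC 2^-1)) (rmorphM _ (fpsC 4^-1)).
rewrite rmorphD !rmorphXn rmorph_nat /= -/Xx.
move: fpsX (fpsC 'X) Xx tau CC (fps_map _ _) (fps_map _ _) => t x Y T C q p.
move=> tE TE CE p2 q4.
have -> : 2 * t * x ^+ 2 * Y * (p * (2 + Y ^+ 3) * (C - q * Y ^+ 3 * C ^+ 2)) =
    (p * 2) * (t * (2 + Y ^+ 3)) * x ^+ 2 * Y * (C - q * Y ^+ 3 * C ^+ 2) by ring.
have -> : x * (2 + Y ^+ 3) - 2 * Y - 2 * (x - Y) * (1 - 2 * T * C) =
    x * Y ^+ 3 + (x - Y) * (T * 4) * C by ring.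
have qT : q * (T * 4) = T by rewrite mulrCA q4 mulr1.
rewrite p2 tE TE.
have -> : 1 * Y * x ^+ 2 * Y * (C - q * Y ^+ 3 * C ^+ 2) =
    x ^+ 2 * Y ^+ 2 * C - x * Y ^+ 3 * (q * (x * Y ^+ 2)) * C ^+ 2 by ring.
rewrite -TE qT.
(* Adding and subtracting [x * Y ^+ 3] makes [1 + T * C ^+ 2] appear, which is [C]. *)
have -> : x * Y ^+ 3 * T * C ^+ 2 = x * Y ^+ 3 * (1 + T * C ^+ 2) - x * Y ^+ 3 by ring.
by rewrite -CE TE; ring.
Qed.

(** The coefficients of [x^i] in [C(tau)] and [C(tau)^2] are [catalan i] and [catalan i.+1] times
    [(X^2/4)^i]; the factor [fpsX] turns the prefactor into [X / 2]. *)
Lemma xcoef_candidate i :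
  fpsX * xcoef i Qx0_candidate = fpsC (2 * 4 ^+ i)^-1 * X ^+ (2 * i + 1) *
    (fpsC (catalan i) - fpsC (catalan i.+1 / 4) * X ^+ 3).
Proof.
rewrite /Qx0_candidate xcoefCM raddfB /= xcoefCM -rmorphXn /= !xcoef_subst//.
rewrite coef_catalan_fps_sqr -[catalan_fps i]/(catalan i).
move: (catalan i) (catalan i.+1) => c d.
rewrite /h exprMn -exprM -rmorphXn /= addn1 [X ^+ (2 * i).+1]exprSr.
rewrite invfM -exprVn !rmorphM /= [fpsC (_ ^+ i)]rmorphXn /=.
have -> u v : fpsX * (u * (2 + X ^+ 3) * v) = u * X * v :> {fps rat}.
  by rewrite {2}X_eq; ring.
move: (fpsC 2^-1) (fpsC 4^-1) (fpsC c) (fpsC d) (X ^+ (2 * i)).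
by move=> p q u v Y; ring.
Qed.

End Candidate.

(** * Counting walks by their last step *)

Section Walks.
Local Open Scope classical_set_scope.

(** The guard excludes a diagonal predecessor outside the quadrant, where [.-1] would silently
    return 0. *)
Lemma walks_rcons (i j n : nat) : walks i j n.+1 =
  (fun w => rcons w (i%:Z, j%:Z)) @`
    (walks i.+1 j n `|` walks i j.+1 n `|`
     (if (0 < i)%N && (0 < j)%N then walks i.-1 j.-1 n else set0)).
Proof.
apply/seteqP; split=> [w [ws w0 wn wst wpos]|_ [w ww <-]].
  case/lastP: w ws w0 wn wst wpos => [//|w v].
  rewrite size_rcons nth_rcons => -[ws]; rewrite ws /= => w0.
  rewrite nth_rcons ws ltnn eqxx => -> wst wpos.
  have wE k : (k <= n)%N -> (rcons w (i%:Z, j%:Z))`_k = w`_k.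
    by move=> kn; rewrite nth_rcons ws ltnS kn.
  exists w => //.
  have wst' k : (k < n)%N -> w`_k.+1 - w`_k \in kreweras_steps.
    by move=> kn; rewrite -!wE ?(ltnW kn)//; apply: wst; lia.
  have wpos' k : (k <= n)%N -> 0 <= (w`_k).1 /\ 0 <= (w`_k).2.
    by move=> kn; rewrite -wE//; apply: wpos; lia.
  have := wst n (leqnn _); rewrite (wE n)// nth_rcons ws ltnn eqxx.
  have := wpos' n (leqnn _).
  case wn : (w`_n) => [a b] /= [a0 b0]; rewrite !inE => /or3P[] /eqP[ia jb].
  - left; right; split=> //; rewrite wn; congr (_, _); lia.
  - left; left; split=> //; rewrite wn; congr (_, _); lia.
  - right; have -> : (0 < i)%N && (0 < j)%N by lia.
    by split=> //; rewrite wn; congr (_, _); lia.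
(* Conversely, the three kinds of predecessors are treated at once, through their endpoint
   [(i', j')]. *)
have : exists i' j', walks i' j' n w /\
    (i%:Z - i'%:Z, j%:Z - j'%:Z) \in kreweras_steps.
  case: ww => [[ww|ww]|].
  - by exists i.+1, j; split=> //; rewrite !inE; apply/or3P/Or32/eqP; congr (_, _); lia.
  - by exists i, j.+1; split=> //; rewrite !inE; apply/or3P/Or31/eqP; congr (_, _); lia.
  - case: ifP => // ij ww; exists i.-1, j.-1; split=> //.
    by rewrite !inE; apply/or3P/Or33/eqP; congr (_, _); lia.
move=> [i' [j' [[ws w0 wn wst wpos] st]]].
have wE k : (k <= n)%N -> (rcons w (i%:Z, j%:Z))`_k = w`_k.
  by move=> kn; rewrite nth_rcons ws ltnS kn.
have wl : (rcons w (i%:Z, j%:Z))`_n.+1 = (i%:Z, j%:Z).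
  by rewrite nth_rcons ws ltnn eqxx.
split=> [|||k kn|k kn]; rewrite ?size_rcons ?ws ?wl ?(wE 0)//.
- have [kn'|kn'] := ltnP k n; first by rewrite !wE ?(ltnW kn')//; apply: wst.
  have -> : k = n by lia.
  by rewrite wl wE// wn.
- have [kn'|kn'] := leqP k n; first by rewrite wE//; apply: wpos.
  have -> : k = n.+1 by lia.
  by rewrite wl.
Qed.

Lemma nwalks0 (i j : nat) : nwalks i j 0 = ((i == 0) && (j == 0))%N.
Proof.
have [/andP[/eqP-> /eqP->]|ij] := boolP ((i == 0) && (j == 0))%N; last first.
  by rewrite nwalks_eq0//; lia.
rewrite /nwalks; suff -> : walks 0 0 0 = [set [:: 0]] by rewrite fset_set1 cardfs1.
apply/seteqP; split=> [[|v [|v' w]] // [_ /= -> //]|_ ->].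
by split=> // -[].
Qed.

Lemma walks_disjoint (i j i' j' n : nat) : (i, j) <> (i', j') ->
  walks i j n `&` walks i' j' n = set0.
Proof.
move=> ij; apply/seteqP; split=> // w [[_ _ wn _ _] [_ _ wn' _ _]].
by case: ij; move: wn'; rewrite wn => -[-> ->].
Qed.

Lemma card_fset_setU (T : choiceType) (A B : set T) :
    finite_set A -> finite_set B -> A `&` B = set0 ->
  #|` fset_set (A `|` B)| = (#|` fset_set A| + #|` fset_set B|)%N.
Proof.
move=> fA fB AB0; rewrite fset_setU// cardfsU -fset_setI// AB0 fset_set0.
by rewrite cardfs0 subn0.
Qed.

Lemma card_fset_set_image (T U : choiceType) (f : T -> U) (A : set T) :
  finite_set A -> injective f -> #|` fset_set (f @` A)| = #|` fset_set A|.
Proof.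
by move=> fA f_inj; rewrite fset_set_image// card_imfset.
Qed.

Lemma nwalksS (i j n : nat) : nwalks i j n.+1 =
  (nwalks i.+1 j n + nwalks i j.+1 n +
   (if (0 < i)%N && (0 < j)%N then nwalks i.-1 j.-1 n else 0))%N.
Proof.
rewrite {1}/nwalks walks_rcons card_fset_set_image; last exact: rcons_injl.
- rewrite card_fset_setU; first last.
  + case: ifP => ij; last by rewrite setI0.
    by rewrite setIUl !walks_disjoint ?setU0// => -[]; lia.
  + by case: ifP => // _; exact: finite_walks.
  + by rewrite finite_setU; split; exact: finite_walks.
  rewrite card_fset_setU; try exact: finite_walks; last first.
    by rewrite walks_disjoint// => -[]; lia.
  by case: ifP => // _; rewrite fset_set0 cardfs0.
- rewrite !finite_setU; split; first by split; exact: finite_walks.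
  by case: ifP => // _; exact: finite_walks.
Qed.

Lemma nwalksC (i j n : nat) : nwalks i j n = nwalks j i n.
Proof.
elim: n i j => [|n IH] i j; first by rewrite !nwalks0 andbC.
rewrite !nwalksS andbC (IH i.+1) (IH i) (IH i.-1).
by rewrite [(nwalks j _ n + _)%N]addnC.
Qed.

End Walks.

(** * The functional equation for Q(x,y) *)

Section FunctionalEquation.

Local Notation x := (fpsC ('X%:P) : {fps {poly {poly rat}}}).
Local Notation y := (fpsC 'X : {fps {poly {poly rat}}}).

Lemma coef_Qx0 n i : (Qx0 n)`_i = (nwalks i 0 n)%:R.
Proof. by rewrite -coef_Qxy /= horner_coef0. Qed.

(** The subtracted terms are the steps that would leave the quadrant. As [y] is the outer variable,
    [fps_map polyC Qx0] is R(x) and [fps_map (map_poly polyC) Qx0] is R(y). *)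
Lemma Qxy_eq : x * y * Qxy =
  x * y + fpsX * ((x + y + x ^+ 2 * y ^+ 2) * Qxy
                  - x * fps_map polyC Qx0 - y * fps_map (map_poly polyC) Qx0).
Proof.
have E1 : x * y = fpsC ('X%:P * 'X) by rewrite rmorphM.
have E2 : x + y + x ^+ 2 * y ^+ 2 = fpsC ('X%:P + 'X + 'X%:P * ('X%:P * ('X * 'X))).
  by rewrite !expr2 -!mulrA !(rmorphD, rmorphM).
rewrite E1 E2; apply: fpsP => -[|n].
  rewrite coef_fpsCM coef_fpsD coef_fpsXM addr0.
  have -> : Qxy 0%N = 1; last by rewrite mulr1.
  apply/polyP => j; apply/polyP => i; rewrite coef_Qxy nwalks0 coef1.
  by case: j => [|j]; rewrite ?coef1 ?coef0; case: i.
rewrite coef_fpsD coef_fpsXM !coef_fpsB !coef_fpsCM [fpsC _ _]/= add0r.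
rewrite -[fps_map polyC _ _]/((Qx0 n)%:P).
rewrite -[fps_map (map_poly _) _ _]/(map_poly polyC (Qx0 n)).
have q'E j i : (Qxy n.+1)`_j`_i = (nwalks i j n.+1)%:R by exact: coef_Qxy.
have qE j i : (Qxy n)`_j`_i = (nwalks i j n)%:R by exact: coef_Qxy.
have rE i : (Qx0 n)`_i = (nwalks i 0 n)%:R by exact: coef_Qx0.
move: (Qxy n.+1) (Qxy n) (Qx0 n) q'E qE rE => q' q r q'E qE rE.
apply/polyP => j; apply/polyP => i.
rewrite !mulrDl -!mulrA !(coefB, coefD, coefCM, coefXM, coefC, coef_map).
(* The monomials shift each exponent by at most 2, so 0, 1 and larger indices are separated;
   [nwalksC] identifies Q(0,y) with R(y). *)
case: i j => [|[|i]] [|[|j]] /=; rewrite ?coef0 ?coefC ?qE ?q'E ?rE /=;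
  rewrite ?nwalksS ?natrD /= ?(nwalksC 0 j.+1); ring.
Qed.

End FunctionalEquation.

Lemma fps_sqrtP (R : comUnitRingType) (f : {fps R}) :
    (2 : R) \is a GRing.unit -> f 0%N = 1 ->
  fps_sqrt f ^+ 2 = f /\ fps_sqrt f 0%N = 1.
Proof.
by move=> u2 f0; have [s [[<- s0] _]] := fps_sqrt_unique u2 f0; rewrite fps_sqrt_eq.
Qed.

Lemma fps_sqrt_discriminant (X : {fps rat}) (X_eq : X = fpsX * (2 + X ^+ 3)) :
  let f := 1 - fpsC 'X * fps_map polyC X ^+ 2 in
  fps_sqrt f ^+ 2 = f /\ fps_sqrt f 0%N = 1.
Proof.
apply: fps_sqrtP.
  by rewrite -(rmorph_nat (@polyC rat)); apply: rmorph_unit; rewrite unitfE.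
rewrite coef_fpsB coef_fps1 coef_fpsCM coef_fpsX0 -[fps_map _ _ _]/((X 0%N)%:P).
by rewrite (X_coef0 X_eq) expr0n mulr0 subr0.
Qed.

(** Applied with the substitutions at [x] and at [Y], and with the embedding into Laurent series. *)
Lemma candidate_morph (X : {fps rat}) (X_eq : X = fpsX * (2 + X ^+ 3))
    (R : comNzRingType) (g : {rmorphism {fps {poly rat}} -> R}) :
  let T := g (fps_map polyC X) in let x := g (fpsC 'X) in
  let S := g (fps_sqrt (1 - fpsC 'X * fps_map polyC X ^+ 2)) in
  S ^+ 2 = 1 - x * T ^+ 2 /\
  2 * g fpsX * x ^+ 2 * T * g (Qx0_candidate X_eq) =
    x * (2 + T ^+ 3) - 2 * T - 2 * (x - T) * S.
Proof.
have := Qx0_candidate_eq X_eq.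
have [] := fps_sqrt_discriminant X_eq.
move: (Qx0_candidate _) (fps_map _ _) (fpsC _) => Q Xx z.
move: (fps_sqrt _) => S SE _ E; split; first by rewrite -rmorphXn SE; ring.
have -> : 2 * g fpsX * g z ^+ 2 * g Xx * g Q = g (2 * fpsX * z ^+ 2 * Xx * Q).
  by ring.
by rewrite E; ring.
Qed.

(** * The kernel method: vanishing of the kernel, uniqueness, and verification of the candidate *)

Section Kernel.
Local Notation s := (fpsX : {fps {poly rat}}).
Local Notation x := (fpsC 'X : {fps {poly rat}}).
Variables (Y : {fps {poly rat}}) (Y_eq : Y = s * (x + Y + x ^+ 2 * Y ^+ 2)).

Fact xs_coef0 : (x * s) 0%N = 0.
Proof. by rewrite coef_fpsCM mulr0. Qed.

Fact kernel_comm : commr_rmorph (@fpsC {poly rat}) Y.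
Proof. by move=> a; exact: mulrC. Qed.

(* The substitution x := x, y := Y, t := x s. *)
Definition kernel_subst : {fps {poly {poly rat}}} -> {fps {poly rat}} :=
  fps_subst (horner_morph kernel_comm) xs_coef0.
HB.instance Definition _ := GRing.RMorphism.on kernel_subst.

Local Notation atx := (fun F => kernel_subst (fps_map polyC F)).
Local Notation aty := (fun F => kernel_subst (fps_map (map_poly polyC) F)).

Lemma Y_coef0 : Y 0%N = 0.
Proof. by rewrite Y_eq coef_fpsXM. Qed.

Lemma Y_coef1 : Y 1%N = 'X.
Proof.
rewrite Y_eq coef_fpsXM !coef_fpsD Y_coef0 addr0 coef_fpsM0 !coef_fpsX0.
by rewrite Y_coef0 expr0n mulr0 addr0.
Qed.

Lemma kernel_mulXI : injective ( *%R x).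
Proof. by move=> a b; apply: (@fps_mulfI _ _ _ _ 0); rewrite polyX_eq0. Qed.

Lemma kernel_substX : kernel_subst fpsX = x * s.
Proof. exact: fps_substX. Qed.

Lemma kernel_substCx : kernel_subst (fpsC 'X%:P) = x.
Proof. by rewrite /kernel_subst fps_substC; exact: horner_morphC. Qed.

Lemma kernel_substCy : kernel_subst (fpsC 'X) = Y.
Proof. by rewrite /kernel_subst fps_substC; exact: horner_morphX. Qed.

(** If [D] vanishes below degree [n], then, because t becomes [x * s], the first term contributes
    [x * D n * x^n] in degree [n] of [s]; the second contributes nothing there, as [Y] brings one
    more factor [s]. *)
Lemma kernel_uniq D : x * atx D + Y * aty D = 0 -> D = 0.
Proof.
move=> D0; apply: fpsP => n; rewrite coef_fps0; elim/ltn_ind: n => n IH.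
have xD k : (k < n)%N -> (fps_map (@polyC {poly rat}) D) k = 0.
  by move=> /IH Dk; rewrite /= Dk rmorph0.
have yD k : (k < n)%N -> (fps_map (map_poly (@polyC rat)) D) k = 0.
  by move=> /IH Dk; rewrite /= Dk rmorph0.
have := congr1 (fun F : {fps {poly rat}} => F n) D0.
rewrite coef_fpsD coef_fpsCM coef_fps0 (@coef_fpsM_lt _ Y _ 1 n)//; first last.
- by move=> k; exact: fps_subst_lt.
- by case=> // _; exact: Y_coef0.
rewrite addr0 /kernel_subst fps_subst_low//.
rewrite [X in fps_coef X 0%N](_ : _ = fpsC (D n)); last exact: horner_morphC.
rewrite coef_fpsCM mulr1.
by move/eqP; rewrite !mulf_eq0 expf_eq0 polyX_eq0 andbF orbF => /eqP.
Qed.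

Variables (X : {fps rat}) (X_eq : X = fpsX * (2 + X ^+ 3)).

(** Under the substitution both [x Y Q] and the kernel part on the right become equal by [Y_eq] and
    cancel; a common factor [x] remains to be removed. *)
Lemma Qx0_kernel : Y = s * (x * atx Qx0 + Y * aty Qx0).
Proof.
have := congr1 kernel_subst Qxy_eq.
rewrite !(rmorphB, rmorphD, rmorphM, rmorphXn) /=.
rewrite kernel_substX kernel_substCx kernel_substCy.
move: (kernel_subst _) (kernel_subst _) (kernel_subst _) => R2 R1 Q H.
have YE : s * (x + Y + x * x * (Y * Y)) = Y by rewrite -!expr2 -Y_eq.
apply: kernel_mulXI; move: H YE; move: s x => s x H YE.
have -> : x * (s * (x * R1 + Y * R2)) = x * (s * (x + Y + x * x * (Y * Y))) * Q -
    x * s * ((x + Y + x * x * (Y * Y)) * Q - x * R1 - Y * R2) by ring.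
by rewrite YE H addrK.
Qed.

Let f : {rmorphism {fps rat} -> {fps {poly rat}}} :=
  kernel_subst \o fps_map (@polyC {poly rat}) \o fps_map (@polyC rat).

Let T_eq : f X = x * s * (2 + f X ^+ 3).
Proof.
have := congr1 f X_eq; rewrite rmorphM rmorphD rmorphXn rmorph_nat.
by rewrite [f fpsX]/= !fps_mapX kernel_substX.
Qed.

Let T_coef : f X 0%N = 0 /\ f X 1%N = 'X * 2.
Proof.
have T0 : f X 0%N = 0 by rewrite T_eq -mulrA coef_fpsCM coef_fpsXM mulr0.
split=> //; rewrite T_eq -mulrA coef_fpsCM coef_fpsXM coef_fpsD coef_fpsX0 T0.
by rewrite expr0n addr0 coef_fpsD !coef_fps1.
Qed.

Lemma kernel_coef0 (F : {fps {poly {poly rat}}}) :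
  F 0%N = 1 -> kernel_subst F 0%N = 1.
Proof.
by move=> F0; rewrite /kernel_subst fps_subst_low// F0 expr0 mulr1 rmorph1.
Qed.

Lemma candidate_kernel :
  Y = s * (x * atx (Qx0_candidate X_eq) + Y * aty (Qx0_candidate X_eq)).
Proof.
have [_ S0] := fps_sqrt_discriminant X_eq.
have := candidate_morph X_eq (kernel_subst \o fps_map (@polyC {poly rat})).
have := candidate_morph X_eq (kernel_subst \o fps_map (map_poly (@polyC rat))).
set S := fps_sqrt _ => /=.
have S1 : kernel_subst (fps_map polyC S) 0%N = 1.
  by apply: kernel_coef0; rewrite /= S0.
have S2 : kernel_subst (fps_map (map_poly polyC) S) 0%N = 1.
  by apply: kernel_coef0; rewrite /= S0 rmorph1.
(* [X] involves neither variable, so both substitutions send it to the same series, called [T]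
   below. *)
have -> : fps_map (map_poly polyC) (fps_map polyC X) = fps_map polyC (fps_map polyC X).
  by apply: fpsP => n /=; rewrite map_polyC.
rewrite !fps_mapC !fps_mapX /= map_polyX kernel_substX kernel_substCx kernel_substCy.
rewrite -[kernel_subst (fps_map polyC (fps_map polyC X))]/(f X).
have two0 : 2 != 0 :> {poly rat} by rewrite -(rmorph_nat (@polyC rat)) polyC_eq0.
have [T0 T1] := T_coef; have Y0 := Y_coef0; have Y1 := Y_coef1.
have T_I : injective ( *%R (f X)).
  by move=> a b; apply: (@fps_mulfI _ _ _ _ 1); rewrite T1 mulf_eq0 polyX_eq0.
have Y_I : injective ( *%R Y).
  by move=> a b; apply: (@fps_mulfI _ _ _ _ 1); rewrite Y1 polyX_eq0.
have x_I := kernel_mulXI; have YE := Y_eq.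
move: (f X) T_eq T0 T1 T_I (kernel_subst _) (kernel_subst _) (kernel_subst _)
  (kernel_subst _) S1 S2.
move=> T TE T0 T1 T_I R1 R2 S2 S1 S10 S20 [S2E E2] [S1E E1].
(* This is [1/t = 1/x + 1/Y + xY] without denominators, [1/t] being [(2 + T^3) / T]. *)
have W : T * (x + Y + x ^+ 2 * Y ^+ 2) = x * Y * (2 + T ^+ 3).
  apply: fpsXI; rewrite mulrCA -YE {1}TE.
  by move: s x => s x; ring.
(* This is [Z(x) + Z(Y) = 0] multiplied by [x Y T]. It is obtained by cancelling the similarly
   scaled [Z(x) - Z(Y)], whose coefficient of degree 1 is [2 x^2]. *)
have Z0 : Y * (x - T) * S1 + x * (Y - T) * S2 = 0.
  apply: (@fps_mulfI _ (Y * (x - T) * S1 - x * (Y - T) * S2) _ _ 1).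
    have YT0 k : (k < 1)%N -> (Y - T) k = 0.
      by case: k => // _; rewrite coef_fpsB Y0 T0 subrr.
    rewrite coef_fpsB -!mulrA coef_fpsCM (@coef_fpsM_low _ Y _ 1 0)//; last by case.
    rewrite (@coef_fpsM_low _ (Y - T) _ 1 0)// coef_fpsM0 S10 S20 !coef_fpsB.
    rewrite Y1 T1 T0 !mulr1 subr0 [fpsC _ _]/= -mulrBr.
    have -> : 'X - ('X - 'X * 2) = 'X * 2 :> {poly rat} by ring.
    by rewrite !mulf_eq0 polyX_eq0.
  have -> : (Y * (x - T) * S1 - x * (Y - T) * S2) * (Y * (x - T) * S1 + x * (Y - T) * S2)
     = (Y * (x - T)) ^+ 2 * S1 ^+ 2 - (x * (Y - T)) ^+ 2 * S2 ^+ 2 by ring.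
  rewrite S1E S2E mulr0.
  have -> : (Y * (x - T)) ^+ 2 * (1 - x * T ^+ 2) - (x * (Y - T)) ^+ 2 * (1 - Y * T ^+ 2)
     = T * (Y - x) * (T * (x + Y + x ^+ 2 * Y ^+ 2) - x * Y * (2 + T ^+ 3)).
    by move: x => x; ring.
  by rewrite W subrr mulr0.
have two_I : injective ( *%R (2 : {fps {poly rat}})).
  move=> a b; apply: (@fps_mulfI _ _ _ _ 0).
  by rewrite -(rmorph_nat (@fpsC {poly rat})).
(* Multiplication by [2 s x^2 Y T] turns the goal into a combination of [E1] and [E2]. *)
apply: T_I; apply: Y_I; apply/x_I/x_I; apply: fpsXI; apply: two_I.
transitivity (s * (Y * (2 * (x * s) * x ^+ 2 * T * R1) +
                   x * (2 * (x * s) * Y ^+ 2 * T * R2))); last first.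
  by move: s x => s x; ring.
rewrite E1 E2; move: TE YE Z0 => {E1 E2 W}; move: s x => s x TE YE Z0.
have -> : s * (Y * (x * (2 + T ^+ 3) - 2 * T - 2 * (x - T) * S1) +
               x * (Y * (2 + T ^+ 3) - 2 * T - 2 * (Y - T) * S2)) =
    2 * Y * (x * s * (2 + T ^+ 3)) - 2 * T * s * (x + Y)
    - 2 * s * (Y * (x - T) * S1 + x * (Y - T) * S2) by ring.
rewrite -TE Z0 mulr0 subr0.
have -> : 2 * Y * T - 2 * T * s * (x + Y) = 2 * T * (Y - s * (x + Y)) by ring.
have -> : Y - s * (x + Y) = s * (x ^+ 2 * Y ^+ 2) by rewrite {1}YE; ring.
by ring.
Qed.

End Kernel.

(** Both series satisfy the same kernel equation, so [kernel_uniq] applies to their difference. *)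
Lemma Qx0E (X : {fps rat}) (X_eq : X = fpsX * (2 + X ^+ 3)) :
  Qx0 = Qx0_candidate X_eq.
Proof.
have [|Y [Y_eq _]] := @fps_fixpoint {poly rat}
    (fun Y => fpsX * (fpsC 'X + Y + fpsC 'X ^+ 2 * Y ^+ 2)).
  move=> f g [|n] fg; rewrite !coef_fpsXM// !coef_fpsD.
  rewrite fg//; congr (_ + _); apply: coef_fpsM_ext => // k kn.
  by rewrite !expr2; apply: coef_fpsM_ext => l lk; apply: fg; lia.
apply/eqP; rewrite -subr_eq0; apply/eqP/(kernel_uniq Y_eq).
have := Qx0_kernel Y_eq; rewrite {1}(candidate_kernel Y_eq X_eq) => /(@fpsXI _ _ _) E.
apply/eqP; rewrite !rmorphB !mulrBr addrACA -opprD subr_eq0; exact/eqP/esym.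
Qed.

(** * The closed formula for the number of walks *)

Lemma raneyE p k n : (0 < k)%N ->
  raney p k n = k%:R / (p * n + k)%:R * 'C(p * n + k, n)%:R.
Proof.
move=> k0; case: n => [|m] /=.
  by rewrite muln0 bin0 mulfV ?mulr1// pnatr_eq0 -lt0n.
have /(congr1 (fun n => n%:R : rat)) := mul_bin_diag (p * m.+1 + k) m.
rewrite -subn1 !natrM => E.
have N0 : (p * m.+1 + k)%:R != 0 :> rat by rewrite pnatr_eq0; lia.
have m0 : m.+1%:R != 0 :> rat by rewrite pnatr_eq0.
have key (N a b c d : rat) : N != 0 -> c != 0 -> N * a = c * b -> d / c * a = d / N * b.
  move=> N0' c0 /(canRL (mulKf N0')) ->; field; exact/andP.
exact: key.
Qed.

(** Writing [X = 2 t F] gives [F = 1 + 4 t^3 F^3], to which [coef_fuss_catalan] applies. *)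
Lemma coef_X_exp (X : {fps rat}) : X = fpsX * (2 + X ^+ 3) -> forall k n,
  (X ^+ k) (3 * n + k)%N = 2 ^+ k * 4 ^+ n * raney 3 k n.
Proof.
move=> X_eq k n; pose F := fpsC 2^-1 * (2 + X ^+ 3).
have half : fpsC 2^-1 * 2 = 1 :> {fps rat} by exact: (rmorph_natV (@fpsC rat) 1).
have XF : X = 2 * fpsX * F.
  have -> : 2 * fpsX * F = fpsC 2^-1 * 2 * (fpsX * (2 + X ^+ 3)).
    by rewrite /F; move: (fpsC _) (2 + _) => h u; ring.
  by rewrite half mul1r -X_eq.
have FE : F = 1 + fpsC 4 * fpsX ^+ 3 * F ^+ 3.
  rewrite {1}/F mulrDr half {1}XF !exprMn (rmorph_nat (@fpsC rat) 4).
  have -> : 2 ^+ 3 = 2 * 4 :> {fps rat} by ring.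
  by rewrite -!mulrA [_ * (2 * _)]mulrA half mul1r.
rewrite {1}XF exprMn exprMn -mulrA -(rmorph_nat (@fpsC rat)) -rmorphXn coef_fpsCM.
by rewrite coef_fpsXnM leq_addl addnK (coef_fuss_catalan FE) mulrA.
Qed.

Lemma central_binS i :
  (i.+1%:R : rat) * 'C(2 * i.+1, i.+1)%:R = 2 * (2 * i + 1)%:R * 'C(2 * i, i)%:R.
Proof.
have Ed := mul_bin_diag (2 * i.+1) i; have El := mul_bin_down (2 * i).+1 i.
have E1 : ((2 * i.+1).-1 = 2 * i + 1)%N by lia.
have E2 : ((2 * i).+1 - i = i.+1)%N by lia.
rewrite E1 in Ed; rewrite E2 -addn1 addn1 /= -addn1 in El.
by rewrite -!natrM -Ed -!mulnA El; congr _%:R; rewrite mulnA mulnCA mulnA.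
Qed.

(** Degree [3n + 2i + 1] is read off in [xcoef_candidate], the extra 1 coming from its factor
    [fpsX]. The powers [X^(2i+1)] and [X^(2i+4)] contribute, and both are expressed through
    ['C(3 * n + 2 * i, n)]. *)
Lemma nwalks_formula i n :
  (nwalks i 0 (3 * n + 2 * i))%:R =
    (4 ^+ n * (2 * i + 1)%:R) / ((n + i + 1)%:R * (2 * n + 2 * i + 1)%:R)
    * 'C(2 * i, i)%:R * 'C(3 * n + 2 * i, n)%:R :> rat.
Proof.
have [X [X_eq _]] := exists_unique_X rat.
have := xcoef_candidate X_eq i; rewrite -(Qx0E X_eq).
move/(congr1 (fun F : {fps rat} => F (3 * n + 2 * i).+1)).
rewrite coef_fpsXM [xcoef _ _ _]/= [LHS](coef_Qx0 (3 * n + 2 * i) i) => ->.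
have cE : catalan i = 'C(2 * i, i)%:R / (i%:R + 1) by rewrite /catalan mulrC natr1.
have dE : catalan i.+1 =
    2 * (2 * i%:R + 1) * 'C(2 * i, i)%:R / ((i%:R + 1) * (i%:R + 2)).
  have -> : 2 * i%:R + 1 = (2 * i + 1)%:R :> rat by rewrite natrD natrM.
  rewrite -central_binS /catalan.
  have -> : (i%:R + 1) * (i%:R + 2) = i.+1%:R * i.+2%:R :> rat by rewrite -!natr1; ring.
  move: ('C(_, _)%:R) => c; have i1 : i.+1%:R != 0 :> rat by rewrite pnatr_eq0.
  have i2 : i.+2%:R != 0 :> rat by rewrite pnatr_eq0.
  by move: i1 i2; move: i.+1%:R i.+2%:R => a b a0 b0; field; exact/andP.
have ME : (3 * n + 2 * i).+1%:R = 3 * n%:R + 2 * i%:R + 1 :> rat.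
  by rewrite -natr1 natrD 2!natrM.
have BE : 'C((3 * n + 2 * i).+1, n)%:R =
    (3 * n%:R + 2 * i%:R + 1) * 'C(3 * n + 2 * i, n)%:R / (2 * n%:R + 2 * i%:R + 1) :> rat.
  have := mul_bin_down (3 * n + 2 * i).+1 n.
  have -> : ((3 * n + 2 * i).+1 - n = 2 * n + 2 * i + 1)%N by lia.
  move/(congr1 (fun n => n%:R : rat)); rewrite /= 2!natrM ME => ->.
  rewrite 2!natrD 2!natrM mulrAC mulfV ?mul1r// -[2 * n%:R](natrM _ 2).
  by rewrite -[2 * i%:R](natrM _ 2) -natrD natr1 pnatr_eq0.
have pow4 : 2 ^+ (2 * i) = 4 ^+ i :> rat.
  by rewrite exprM; congr (_ ^+ _); ring.
have X1 : (X ^+ (2 * i + 1)) (3 * n + 2 * i).+1 =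
    2 * 4 ^+ i * 4 ^+ n * ((2 * i%:R + 1) / (3 * n%:R + 2 * i%:R + 1) *
    'C((3 * n + 2 * i).+1, n)%:R).
  have -> : (3 * n + 2 * i).+1 = (3 * n + (2 * i + 1))%N by lia.
  rewrite coef_X_exp// raneyE ?addn1// addnS ME exprS pow4 -[(2 * i).+1%:R]natr1 natrM.
  by rewrite -!mulrA.
have X2 : (X ^+ (2 * i + 4)) (3 * n + 2 * i).+1 =
    4 * 4 ^+ i * 4 ^+ n * ((2 * i%:R + 4) / (3 * n%:R + 2 * i%:R + 1) *
    'C((3 * n + 2 * i).+1, n)%:R * n%:R / (2 * n%:R + 2 * i%:R + 2)).
  (* For [n = 0] the order [2i + 4] exceeds the index and the factor [n] is zero; otherwise the
     index is [3(n-1) + (2i + 4)]. *)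
  rewrite -ME; case: n {ME BE X1} => [|m].
    by rewrite coef_fpsX_lt ?(X_coef0 X_eq)//; [rewrite mulr0 mul0r mulr0|lia].
  have -> : (3 * m.+1 + 2 * i).+1 = (3 * m + (2 * i + 4))%N by lia.
  rewrite coef_X_exp// raneyE; last by lia.
  have := mul_bin_left (3 * m + (2 * i + 4)) m.
  have -> : (3 * m + (2 * i + 4) - m = 2 * m.+1 + 2 * i + 2)%N by lia.
  move/(congr1 (fun n => n%:R : rat)); rewrite 2!natrM 2!natrD 2!natrM natrD natrM.
  rewrite exprD pow4 exprS.
  have : 2 * m.+1%:R + 2 * i%:R + 2 != 0 :> rat.
    by rewrite -[2 * m.+1%:R](natrM _ 2) -[2 * i%:R](natrM _ 2) -!natrD pnatr_eq0.
  have : (3 * m + (2 * i + 4))%:R != 0 :> rat by rewrite pnatr_eq0; lia.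
  move: (3 * m + (2 * i + 4))%:R ('C(_, _)%:R) ('C(_, _)%:R) m.+1%:R i%:R.
  move=> M b1 b0 N I M0 D0 /esym/(canRL (mulKf D0)) ->; rewrite [4 ^+ m.+1]exprS; field.
  exact/andP.
have -> : fpsC (2 * 4 ^+ i)^-1 * X ^+ (2 * i + 1) *
      (fpsC (catalan i) - fpsC (catalan i.+1 / 4) * X ^+ 3) =
    fpsC ((2 * 4 ^+ i)^-1 * catalan i) * X ^+ (2 * i + 1) -
    fpsC ((2 * 4 ^+ i)^-1 * (catalan i.+1 / 4)) * X ^+ (2 * i + 4).
  rewrite (rmorphM _ (2 * 4 ^+ i)^-1 (catalan i)) (rmorphM _ (2 * 4 ^+ i)^-1 (_ / _)) /=.
  rewrite -[4%N]/(1 + 3)%N addnA (exprD _ (2 * i + 1) 3).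
  by move: (fpsC _) (fpsC _) (fpsC _) (X ^+ (2 * i + 1)) => p q r u; ring.
rewrite coef_fpsB !coef_fpsCM X1 X2 dE cE BE {BE X1 X2 cE dE}.
have -> : (2 * i + 1)%:R = 2 * i%:R + 1 :> rat by rewrite natrD natrM.
have -> : (2 * n + 2 * i + 1)%:R = 2 * n%:R + 2 * i%:R + 1 :> rat.
  by rewrite 2!natrD 2!natrM.
have -> : (n + i + 1)%:R = n%:R + i%:R + 1 :> rat by rewrite 2!natrD.
have : 0 <= i%:R :> rat by rewrite ler0n.
have : 0 <= n%:R :> rat by rewrite ler0n.
have : 4 ^+ i != 0 :> rat by rewrite expf_neq0.
move: ('C(_, _)%:R) ('C(_, _)%:R) n%:R i%:R (4 ^+ i) (4 ^+ n) => u v N I p q.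
move=> p0 N0 I0; field; rewrite p0 andbT.
by do 5?[apply/andP; split]; apply: lt0r_neq0; lra.
Qed.

(** * Passage to Laurent series, where t, x and X are invertible *)

Section LaurentMorphisms.
Variable R : comNzRingType.

Lemma laurent_shift0 (f : {fps R}) : laurent_shift 0 (laurent_of_fps f) = f.
Proof.
apply: fpsP => n; rewrite -[LHS]/(laurent_of_fps f (n%:Z - 0%N%:Z)).
by have -> : n%:Z - 0%N%:Z = n by lia.
Qed.

Fact laurent_of_fps_is_zmod_morphism : zmod_morphism (@laurent_of_fps R).
Proof.
move=> f g; apply: laurentP => k.
rewrite -[RHS]/(laurent_of_fps f k - laurent_of_fps g k).
by case: k => n //=; rewrite subr0.
Qed.
Fact laurent_of_fps_is_monoid_morphism : monoid_morphism (@laurent_of_fps R).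
Proof.
split=> // f g; apply: laurentP => k.
have v0 (h : {fps R}) : vanish 0 (laurent_of_fps h) by case.
rewrite [RHS](laurent_mul_coefE (v0 f) (v0 g)) !laurent_shift0 !addr0.
by case: k.
Qed.
HB.instance Definition _ := GRing.isZmodMorphism.Build {fps R} {laurent R}
  (@laurent_of_fps R) laurent_of_fps_is_zmod_morphism.
HB.instance Definition _ := GRing.isMonoidMorphism.Build {fps R} {laurent R}
  (@laurent_of_fps R) laurent_of_fps_is_monoid_morphism.

HB.instance Definition _ := GRing.RMorphism.copy (@laurentC R)
  (@laurent_of_fps R \o @fpsC R).

Fact laurentXV_bounded :
  exists N : nat, forall k : int, k < - N%:Z -> (k == -1)%:R = 0 :> R.
Proof. by exists 1%N => k; case: eqP => // ->. Qed.
Definition laurentXV := Laurent laurentXV_bounded.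

Lemma laurentXVK : laurentXV * laurentX = 1.
Proof.
apply: laurentP => k.
have v1 : vanish 1 laurentXV by move=> k' /=; case: eqP => // ->.
have v0 : vanish 0 (@laurentX R) by case.
rewrite [LHS](laurent_mul_coefE v1 v0) addr0 laurent_shift0.
have -> : laurent_shift 1 laurentXV = 1.
  by apply: fpsP => n; rewrite coef_fps1 /=; congr (_%:R); lia.
rewrite mul1r; case E : (k + 1%N%:Z) => [m|m]; case: k E => n E //=.
  have -> : m = n.+1 by lia.
  by case: n {E}.
by have -> : m = 0%N by lia.
Qed.

Lemma laurentX_unit : @laurentX R \is a GRing.unit.
Proof. by apply/unitrPr; exists laurentXV; rewrite mulrC laurentXVK. Qed.

Fact lpoly_of_poly_is_zmod_morphism : zmod_morphism (@lpoly_of_poly R).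
Proof.
by move=> p q; apply/val_inj/laurentP => -[n|n] /=; rewrite ?subr0 ?coefB.
Qed.
Fact lpoly_of_poly_is_monoid_morphism : monoid_morphism (@lpoly_of_poly R).
Proof.
split; first by apply/val_inj/laurentP => -[n|n] //=; rewrite coef1; case: n.
move=> p q; apply: val_inj; rewrite /= -rmorphM; congr laurent_of_fps.
by apply: fpsP => n; rewrite coef_fpsM /= coefM.
Qed.
HB.instance Definition _ := GRing.isZmodMorphism.Build {poly R} {lpoly R}
  (@lpoly_of_poly R) lpoly_of_poly_is_zmod_morphism.
HB.instance Definition _ := GRing.isMonoidMorphism.Build {poly R} {lpoly R}
  (@lpoly_of_poly R) lpoly_of_poly_is_monoid_morphism.

Fact laurentXV_lpoly : laurentXV \in @lpoly_pred R.
Proof. by apply/asboolP; exists 0%N => -[n|n]. Qed.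

End LaurentMorphisms.

Lemma laurentCX_unit (R : comNzRingType) :
  laurentC (lpoly_of_poly 'X) \is a @GRing.unit {laurent {lpoly R}}.
Proof.
apply/unitrPr; exists (laurentC (LPoly (laurentXV_lpoly R))).
rewrite -rmorphM -[RHS](rmorph1 (@laurentC (lpoly R))).
congr laurentC.
apply: val_inj; rewrite /= mulrC -laurentXVK; congr (_ * _).
by apply: laurentP => -[n|n] //=; rewrite coefX.
Qed.

Lemma nat_unit (F : numFieldType) (R : comUnitRingType) (f : {rmorphism F -> R}) n :
  n.+1%:R \is a @GRing.unit R.
Proof. by apply/unitrPr; exists (f n.+1%:R^-1); rewrite mulrC rmorph_natV. Qed.

(** Division of the cleared formula, done in any ring where [t], [x] and 2 are units. *)
Lemma kreweras_divide (R : comUnitRingType) (t x T Q S : R) :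
    t \is a GRing.unit -> x \is a GRing.unit -> 2 \is a @GRing.unit R ->
    T = t * (2 + T ^+ 3) ->
    2 * t * x ^+ 2 * T * Q = x * (2 + T ^+ 3) - 2 * T - 2 * (x - T) * S ->
  Q = 1 / (t * x) * (1 / (2 * t) - 1 / x - (1 / T - 1 / x) * S).
Proof.
move=> ut ux u2 TE QE.
have uT : T \is a GRing.unit.
  (* [T] divides the unit [2 t], hence is itself a unit. *)
  have : T * (1 - t * T ^+ 2) = 2 * t by rewrite mulrBr mulr1 {1}TE; ring.
  move=> TE2; have : 2 * t \is a GRing.unit by rewrite unitrM u2.
  by rewrite -TE2 unitrM => /andP[].
have u : 2 * t ^+ 2 * x ^+ 2 * T \is a GRing.unit by rewrite !unitrM u2 uT ut ux.
apply: (mulrI u); rewrite !div1r !invrM//.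
have -> : 2 * t ^+ 2 * x ^+ 2 * T * Q = t * (2 * t * x ^+ 2 * T * Q) by ring.
rewrite QE.
have := mulrV ut; have := mulrV ux; have := mulrV u2; have := mulrV uT.
move: t^-1 x^-1 2^-1 T^-1 => a b h c T1 h1 b1 a1.
have -> : 2 * t ^+ 2 * x ^+ 2 * T * (b * a * (a * h - b - (c - b) * S)) =
  (t * a) * (x * b) * ((t * a) * (2 * h) * x * T - 2 * t * T * (x * b)
     - 2 * t * (x * (T * c) - T * (x * b)) * S) by ring.
have -> : t * (x * (2 + T ^+ 3) - 2 * T - 2 * (x - T) * S) =
  x * (t * (2 + T ^+ 3)) - 2 * t * T - 2 * t * (x - T) * S by ring.
by rewrite -TE T1 h1 b1 a1; ring.
Qed.

Theorem theorem1 (X : {fps rat}) (X_eq : X = fpsX * (2 + X ^+ 3)) :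
  [/\ (* the identity for Q(x,0;t), in Q[x,1/x]((t)) *)
      let t : {laurent {lpoly rat}} := laurentX in
      let x : {laurent {lpoly rat}} := laurentC (lpoly_of_poly 'X) in
      let Xx : {fps {poly rat}} := fps_map polyC X in
      emb Qx0 =
        1 / (t * x) *
        (1 / (2 * t) - 1 / x
         - (1 / emb Xx - 1 / x) * emb (fps_sqrt (1 - fpsC 'X * Xx ^+ 2))),
      (* the coefficient of x^i, with the last equality in Q((t)) *)
      forall i : nat,
        let t : {laurent rat} := laurentX in
        let XL : {laurent rat} := laurent_of_fps X in
        let walks_gf : {fps rat} := Fps (fun n => (nwalks i 0 n)%:R) in
        fps_map (fun p : {poly rat} => p`_i) Qx0 = walks_gf
        /\ laurent_of_fps walks_gf =
             XL ^+ (2 * i + 1) / (2 * 4 ^+ i * t) *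
             (laurentC (catalan i) - laurentC (catalan i.+1) * XL ^+ 3 / 4)
    & forall i n : nat,
        (nwalks i 0 (3 * n + 2 * i))%:R =
          (4 ^+ n * (2 * i + 1)%:R) / ((n + i + 1)%:R * (2 * n + 2 * i + 1)%:R)
          * 'C(2 * i, i)%:R * 'C(3 * n + 2 * i, n)%:R :> rat].
Proof.
split; last exact: nwalks_formula.
- move=> t x Xx.
  (* [g] is [emb], written as a composite that carries the morphism structure. *)
  pose g : {rmorphism {fps {poly rat}} -> {laurent {lpoly rat}}} :=
    @laurent_of_fps {lpoly rat} \o fps_map (@lpoly_of_poly rat).
  have [_] := candidate_morph X_eq g; rewrite -(Qx0E X_eq).
  have -> : g fpsX = t by rewrite /g /= fps_mapX.
  have -> : g (fpsC 'X) = x by rewrite /g /= fps_mapC.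
  apply: kreweras_divide.
  + exact: laurentX_unit.
  + exact: laurentCX_unit.
  + exact: (nat_unit (g \o @fpsC {poly rat} \o @polyC rat) 1).
  have -> : t = g (fps_map polyC fpsX) by rewrite fps_mapX /g /= fps_mapX.
  by rewrite {1}X_eq; ring.
- move=> i t XL W.
  have WE : xcoef i Qx0 = W by apply: fpsP => n; exact: coef_Qx0.
  split; first exact: WE.
  have := congr1 (@laurent_of_fps rat) (xcoef_candidate X_eq i).
  rewrite -(Qx0E X_eq) WE.
  pose L : {rmorphism rat -> {laurent rat}} := @laurentC rat.
  have ut : t \is a GRing.unit by exact: laurentX_unit.
  have u2 : (2 : {laurent rat}) \is a GRing.unit by exact: (nat_unit L 1).
  have u4 : (4 : {laurent rat}) \is a GRing.unit by exact: (nat_unit L 3).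
  rewrite (rmorphM _ fpsX W); move: (catalan i) (catalan i.+1) => c d.
  have -> : laurent_of_fps (fpsC (2 * 4 ^+ i)^-1 * X ^+ (2 * i + 1) *
        (fpsC c - fpsC (d / 4) * X ^+ 3)) =
      L (2 * 4 ^+ i)^-1 * XL ^+ (2 * i + 1) * (L c - L (d / 4) * XL ^+ 3).
    by rewrite 2!rmorphM rmorphXn rmorphB rmorphM rmorphXn.
  have -> : L (2 * 4 ^+ i)^-1 = (2 * 4 ^+ i)^-1.
    by rewrite fmorphV (rmorphM _ 2) rmorphXn !rmorph_nat.
  have -> : L (d / 4) = L d / 4 by rewrite fmorph_div rmorph_nat.
  (* [xcoef_candidate] describes [t] times the series, so both sides are multiplied by [t]. *)
  move=> tW; apply: (mulrI ut); rewrite [LHS]tW.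
  rewrite [(2 * 4 ^+ i * t)^-1]invrM//; last by rewrite unitrM u2 unitrX.
  rewrite [L d / 4 * _]mulrAC; have := mulrV ut; move: (L c - _) => V.
  move: t^-1 (2 * 4 ^+ i)^-1 (XL ^+ (2 * i + 1)) => t' k u tt'.
  have -> : t * (u * (t' * k) * V) = t * t' * (k * u * V) by ring.
  by rewrite tt' mul1r.
Qed.
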